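(* Let $z_1,\dots,z_n$ be distinct complex numbers. Then the subalgebra $\mathcal{B}^S_n(z_1,\dots,z_n)$ of $\mathbb{C}[\mathfrak{S}_n]$ is generated by the elements $H^{[n]}_1,\dots,H^{[n]}_n$. More precisely, $$\Phi^{[n]}(u,v)=\mathcal{P}(u,v;z_1,\dots,z_n;H^{[n]}_1,\dots,H^{[n]}_n).$$
   Context: $\mathfrak{S}_n$ is the symmetric group; $\sigma_{a,b}$ is the transposition of $a$ and $b$. For distinct $r_1,\dots,r_m\in\{1,\dots,n\}$, $\pi^{[n]}_{r_1,\dots,r_m}:\mathbb{C}[\mathfrak{S}_m]\to\mathbb{C}[\mathfrak{S}_n]$ is the embedding induced by $i\mapsto r_i$. $A^{[m]}=\frac1{m!}\sum_{\sigma\in\mathfrak{S}_m}\mathrm{sign}(\sigma)\,\sigma$. For $i=1,\dots,n$ put $$\Phi^{[n]}_i(u)=\sum_{1\le r_1<\dots<r_i\le n} i!\;\pi^{[n]}_{r_1,\dots,r_i}(A^{[i]})\prod_{1\le b\le n,\ b\notin\{r_1,\dots,r_i\}}(u-z_b)=\sum_{j=0}^{n-i}\Phi^{[n]}_{i,j}\,u^{n-i-j}.$$ $\mathcal{B}^S_n(z_1,\dots,z_n)$ is the subalgebra of $\mathbb{C}[\mathfrak{S}_n]$ generated by all $\Phi^{[n]}_{i,j}$, $i=1,\dots,n$, $j=0,\dots,n-i$ (it is commutative). Set $$\Phi^{[n]}(u,v)=v^n\prod_{a=1}^n(u-z_a)+\sum_{i=1}^n(-1)^i\Phi^{[n]}_i(u)\,v^{n-i}.$$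 For distinct $z_1,\dots,z_n$, the (pairwise commuting) KZ elements are $H^{[n]}_a=\sum_{b\ne a}\dfrac{\sigma_{a,b}}{z_a-z_b}$, $a=1,\dots,n$. Let $Z=\mathrm{diag}(z_1,\dots,z_n)$ and let $Q$ be the $n\times n$ matrix with $Q_{aa}=h_a$ and $Q_{ab}=\frac1{z_a-z_b}$ for $a\ne b$, where $h_1,\dots,h_n$ are commuting variables. Put $$\mathcal{P}(u,v;z_1,\dots,z_n;h_1,\dots,h_n)=\det\bigl((u-Z)(v-Q)-1\bigr),$$ a polynomial in $u,v,h_1,\dots,h_n$, where scalars stand for multiples of the identity matrix. *)

(* Defs.v *)
From HB Require Import structures.
From mathcomp Require Import all_boot all_order all_fingroup all_algebra.
From mathcomp Require Import all_field.
From mathcomp Require Import reals complex mpoly.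

Set Implicit Arguments.
Unset Strict Implicit.
Unset Printing Implicit Defensive.

Import GRing.Theory.
Local Open Scope ring_scope.

(* The group algebra K[gT], as functions gT -> K under convolution.  An alias
   of {ffun gT -> K^o}, so that the product is not the pointwise one. *)
Definition galg (K : fieldType) (gT : finGroupType) : Type :=
  {ffun gT -> K^o}.

Section GroupAlgebra.
Variables (K : fieldType) (gT : finGroupType).
Local Notation A := (galg K gT).
Implicit Types f g h : A.

HB.instance Definition _ := Vector.copy A {ffun gT -> K^o}.

Definition galg_one : A := [ffun x => (x == 1%g)%:R].
Definition galg_mul f g : A := [ffun x => \sum_y f y * g (y^-1 * x)%g].

Fact galg_mulA : associative galg_mul.
Proof.
move=> f g h; apply/ffunP=> x; rewrite !ffunE.
under eq_bigr => y _ do rewrite ffunE mulr_sumr.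
under [RHS]eq_bigr => t _ do rewrite ffunE mulr_suml.
rewrite [RHS]exchange_big /=; apply: eq_bigr => y _.
rewrite (reindex_inj (mulgI y^-1%g)) /=; apply: eq_bigr => t _.
by rewrite mulrA invMg invgK !mulgA mulgK.
Qed.

Fact galg_mul1 : left_id galg_one galg_mul.
Proof.
move=> f; apply/ffunP=> x; rewrite ffunE (bigD1 1%g) //= ffunE eqxx mul1r.
rewrite invg1 mul1g big1 ?addr0 // => y /negPf ny.
by rewrite ffunE ny mul0r.
Qed.

Fact galg_mulr1 : right_id galg_one galg_mul.
Proof.
move=> f; apply/ffunP=> x; rewrite ffunE (bigD1 x) //= ffunE mulVg eqxx mulr1.
rewrite big1 ?addr0 // => y ny.
by rewrite ffunE -eq_mulVg1 (negPf ny) mulr0.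
Qed.

Fact galg_mulDl : left_distributive galg_mul +%R.
Proof.
move=> f g h; apply/ffunP=> x; rewrite !ffunE -big_split /=.
by apply: eq_bigr => y _; rewrite ffunE mulrDl.
Qed.

Fact galg_mulDr : right_distributive galg_mul +%R.
Proof.
move=> f g h; apply/ffunP=> x; rewrite !ffunE -big_split /=.
by apply: eq_bigr => y _; rewrite ffunE mulrDr.
Qed.

Fact galg_oner_neq0 : galg_one != 0.
Proof.
by apply/eqP=> /ffunP/(_ 1%g)/eqP; rewrite !ffunE eqxx oner_eq0.
Qed.

HB.instance Definition _ := GRing.Zmodule_isNzRing.Build A
  galg_mulA galg_mul1 galg_mulr1 galg_mulDl galg_mulDr galg_oner_neq0.

Fact galg_scalerAl (k : K) f g : k *: (f * g) = (k *: f) * g.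
Proof.
apply/ffunP=> x; rewrite !ffunE scaler_sumr; apply: eq_bigr => y _.
by rewrite ffunE scalerAl.
Qed.

HB.instance Definition _ := GRing.Lmodule_isLalgebra.Build K A galg_scalerAl.

Fact galg_scalerAr (k : K) f g : k *: (f * g) = f * (k *: g).
Proof.
apply/ffunP=> x; rewrite !ffunE scaler_sumr; apply: eq_bigr => y _.
by rewrite ffunE scalerAr.
Qed.

HB.instance Definition _ := GRing.Lalgebra_isAlgebra.Build K A galg_scalerAr.
HB.instance Definition _ := Algebra_isFalgebra.Build K A.

Definition gelt (x : gT) : A := [ffun y => (y == x)%:R].

Fact gelt1 : gelt 1%g = 1. Proof. by []. Qed.

Fact geltM (x y : gT) : gelt (x * y)%g = gelt x * gelt y.
Proof.
apply/ffunP=> t; rewrite [RHS]ffunE (bigD1 x) //= !ffunE eqxx mul1r.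
rewrite (can2_eq (mulKVg x) (mulKg x)) big1 ?addr0 // => w /negPf nw.
by rewrite ffunE nw mul0r.
Qed.

End GroupAlgebra.

(* For injective r, the permutation r i |-> r (s i) fixing the complement of
   the image of r; insubd gives the identity when r is not injective. *)
Definition ext_perm_fun (m n : nat) (r : 'I_m -> 'I_n) (s : 'S_m) (x : 'I_n) :=
  if [pick i | r i == x] is Some i then r (s i) else x.

Definition ext_perm (m n : nat) (r : 'I_m -> 'I_n) (s : 'S_m) : 'S_n :=
  insubd (1%g : 'S_n) [ffun x => ext_perm_fun r s x].

Section ExtPerm.
Variables (m n : nat) (r : 'I_m -> 'I_n).
Hypothesis r_inj : injective r.

Fact ext_perm_funE s i : ext_perm_fun r s (r i) = r (s i).
Proof.
by rewrite /ext_perm_fun; case: pickP => [j /eqP/r_inj->|/(_ i)/eqP].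
Qed.

Fact ext_perm_fun_out s x : x \notin codom r -> ext_perm_fun r s x = x.
Proof.
rewrite /ext_perm_fun; case: pickP => // i /eqP<-.
by rewrite codom_f.
Qed.

Fact ext_perm_fun_inj s : injective (ext_perm_fun r s).
Proof.
apply: (can_inj (g := ext_perm_fun r s^-1%g)) => x.
have [/codomP[i ->]|xNr] := boolP (x \in codom r).
  by rewrite !ext_perm_funE permK.
by rewrite !ext_perm_fun_out.
Qed.

Fact ext_permE s x : ext_perm r s x = ext_perm_fun r s x.
Proof.
have inj : injectiveb [ffun x => ext_perm_fun r s x].
  by apply/injectiveP => y t; rewrite !ffunE; apply: ext_perm_fun_inj.
by rewrite -pvalE /= insubdK ?ffunE.
Qed.

Fact ext_perm_in s i : ext_perm r s (r i) = r (s i).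
Proof. by rewrite ext_permE ext_perm_funE. Qed.

Fact ext_perm_out s x : x \notin codom r -> ext_perm r s x = x.
Proof. by rewrite ext_permE; apply: ext_perm_fun_out. Qed.

End ExtPerm.

(* In 'S_n, (s * t) x = t (s x).  With right-to-left composition one gets the
   opposite algebra; s |-> s^-1 identifies the two, and it fixes every element
   Phi_coef and KZ below. *)
Section Bethe.
Variable C : fieldType.

Definition group_emb (m n : nat) (r : 'I_m -> 'I_n) (x : galg C 'S_m) :
    galg C 'S_n :=
  \sum_(s : 'S_m) x s *: gelt C (ext_perm r s).

Definition antisymm (m : nat) : galg C 'S_m :=
  (m`!%:R)^-1 *: \sum_(s : 'S_m) (-1) ^+ s *: gelt C s.

Variables (n : nat) (z : 'I_n -> C).
Local Notation A := (galg C 'S_n).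

(* Phi_i(u), with u = 'X; the tuples r are r_1 < ... < r_i. *)
Definition Phi (i : nat) : {poly A} :=
  \sum_(r : i.-tuple 'I_n | sorted ltn (map val r))
    (i`!%:R *: group_emb (tnth r) (antisymm i))%:P *
    \prod_(b < n | b \notin r) ('X - (z b)%:A%:P).

Definition Phi_coef (i j : nat) : A := (Phi i)`_(n - i - j).

Definition bethe_gens : seq A :=
  [seq Phi_coef i j | i <- iota 1 n, j <- iota 0 (n - i).+1].

(* agenv U is the unital subalgebra generated by the subspace U. *)
Definition bethe_subalg : {vspace A} := agenv <<bethe_gens>>%VS.

(* In bivariate polynomials the outer variable is v, the inner one is u. *)
Definition Phi_uv : {poly {poly A}} :=
  'X^n * (\prod_(a < n) ('X - (z a)%:A%:P))%:P +
  \sum_(1 <= i < n.+1) (-1) ^+ i * (Phi i)%:P * 'X^(n - i).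

Definition KZ (a : 'I_n) : A :=
  \sum_(b < n | b != a) (z a - z b)^-1 *: gelt C (tperm a b).

Local Notation Ch := {mpoly C[n]}.

Definition Zmx : 'M[C]_n := diag_mx (\row_a z a).

Definition Qmx : 'M[Ch]_n :=
  \matrix_(a, b) if a == b then 'X_a else ((z a - z b)^-1)%:MP.

Definition char_uv : {poly {poly Ch}} :=
  \det (('X%:P%:M - map_mx (fun c : C => c%:MP%:P%:P) Zmx) *m
        ('X%:M - map_mx (fun q : Ch => q%:P%:P) Qmx) - 1%:M).

(* Substitution of elements h_a of A for the variables.  mmap multiplies the
   powers of the h_a in increasing order of a, which is immaterial here as the
   h_a are meant to commute pairwise. *)
Definition subst_uv (h : 'I_n -> A) (p : {poly {poly Ch}}) : {poly {poly A}} :=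
  map_poly (map_poly (mmap (in_alg A) h)) p.

End Bethe.

(* Main.v *)
Require Import Defs.
From mathcomp Require Import all_boot all_order all_fingroup all_algebra.
From mathcomp Require Import all_field ring.
From mathcomp Require Import reals complex mpoly.

Set Implicit Arguments.
Unset Strict Implicit.
Unset Printing Implicit Defensive.

Import GRing.Theory.
Local Open Scope ring_scope.

(** Fix scalars u, v with u distinct from all z_a, and divide by
    prod_a (u - z_a). Write pole u a = 1 / (u - z_a), Alt_S for the signed sum
    of the permutations supported on S, and H_a for the KZ elements. The
    identity becomes

      D(v - H_a - pole u a)
        = sum_S (-1)^|S| v^(n-|S|) (prod_(a in S) pole u a) Alt_S

    where D(x) is the determinant of the matrix with diagonal x and entries
    - 1 / (z_a - z_b) off the diagonal. Both sides are rational functions of u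
    with simple poles at the z_b, so it suffices to compare the residues and
    the values at u = infinity.

    The determinant. For distinct a, b, c the product of 1 / (z_a - z_b) and
    1 / (z_a - z_c) telescopes, so permutations with a cycle of length at least
    three contribute nothing (det_cauchy_rec). What remains is a sum over
    matchings, match_poly, which is affine in each variable, makes sense for
    elements of a noncommutative algebra, and satisfies
    D_N = x_a D_(N-a) + sum_c (z_a - z_c)^(-2) D_(N-a-c) as soon as x_a
    commutes with the other entries (match_poly_rec).

    The induction. The residue at u = z_b puts z_b at the point u, and is an
    identity of the same kind in which b is fused with u. This suggests
    fused_expansion, where the sites of a set K have been fused at u: K
    contributes the factor Alt_K, and the entry of c in N is
    v - H_c - pole u c (1 - sum_(k in K) s_kc), with H_c computed inside N.
    Since Alt_(K+b) = Alt_K (1 - sum_(k in K) s_kb), taking the residue at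
    u = z_b replaces (K, N) by (K + b, N - b), and N shrinks until it is empty.

    The value at infinity. There one needs D_N(v - H_a) = v^|N|, i.e. the
    matrix Q is nilpotent at the KZ elements (kz_match_poly). It is proved by
    moving one site a: as a function of z_a the left side has at most double
    poles at the other sites. The double poles cancel (match_poly_new_site),
    then so do the simple ones (expanded_residue), and at z_a = infinity the
    site a splits off with a factor v.

    Taking K empty gives the identity at all u, v as above, and polynomials over
    an infinite field are determined by such values. It expresses the
    coefficients of Phi_i by the H_a; conversely H_a is obtained from the value
    of Phi_2 at u = z_a, where only the pairs containing a survive. *)

(** * Determinants of Cauchy-like matrices *)

Section BorderedDet.
Variables (R : comNzRingType) (n : nat).
Implicit Types (M B : 'M[R]_n) (a : 'I_n) (N : {set 'I_n}).

(** B is M with the row and the column of a replaced by those of the identity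
    matrix. Minors are encoded in this way so that all of them are n x n. *)
Definition bordered M B a :=
  (forall i j, i != a -> j != a -> B i j = M i j) /\
  (forall i, B i a = (i == a)%:R /\ B a i = (a == i)%:R).

(** A permutation s with s a = c and c <> a becomes one that fixes a when it is
    multiplied by the transposition (a c); c' is the preimage of a. *)
Lemma cofactor_bordered M B a c : bordered M B a -> c != a ->
  cofactor M a c = - \sum_(c' | c' != a) M c' a * cofactor B c' c.
Proof.
move=> [Bin Bout] ca; rewrite expand_cofactor.
rewrite (reindex_inj (mulIg (tperm a c))) /=.
under eq_bigl => t do rewrite permM (canF_eq (tpermK a c)) tpermR.
under [in RHS]eq_bigr => c' _ do rewrite expand_cofactor mulr_sumr.
rewrite (exchange_big_dep predT) //= -sumrN [RHS](bigID (fun t : 'S_n => t a == a)) /=.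
rewrite [X in _ = _ + X]big1 ?addr0 => [|t ta]; last first.
  apply/eqP; rewrite oppr_eq0; apply/eqP; apply: big1 => c' /andP[c'a _].
  rewrite (bigD1 a) //= (Bout (t a)).2 [a == _]eq_sym (negPf ta) mul0r.
  by rewrite !mulr0.
apply: eq_bigr => t /eqP ta.
have tVc : (t^-1)%g c != a by rewrite (canF_eq (permKV t)) ta.
rewrite [X in _ = - X](big_pred1 ((t^-1)%g c)); last first.
  move=> k /=; rewrite (canF_eq (permK t)) andbC.
  by have [->|] := eqVneq k _; rewrite //= tVc.
rewrite odd_permM odd_tperm eq_sym ca addbT signrN mulNr.
rewrite [X in _ = - X]mulrCA; congr (- (_ * _)).
rewrite (bigD1 ((t^-1)%g c)) 1?eq_sym //= permM permKV tpermR; congr (_ * _).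
rewrite [RHS](bigD1 a) //= ta (Bout a).1 eqxx mul1r.
apply: eq_big => [k|k /andP[ak ck]]; first by rewrite andbC ![k == _]eq_sym.
have tka : t k != a by rewrite -[X in _ != X]ta (inj_eq perm_inj) eq_sym.
rewrite permM tpermD ?[_ == t k]eq_sym // ?Bin ?[k == a]eq_sym //.
by rewrite (canF_eq (permK t)).
Qed.

(** Expansion along a row and the column that crosses it. *)
Lemma det_bordered M B a : bordered M B a ->
  \det M = M a a * \det B
    - \sum_(c | c != a) \sum_(c' | c' != a) M a c * M c' a * cofactor B c' c.
Proof.
move=> MB; have [Bin Bout] := MB; rewrite (expand_det_row M a) (bigD1 a) //=.
rewrite -sumrN; congr (_ * _ + _); last first.
  apply: eq_bigr => c ca; rewrite (cofactor_bordered MB) // mulrN mulr_sumr.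
  by congr (- _); apply: eq_bigr => c' _; rewrite mulrA.
rewrite (expand_det_row B a) (bigD1 a) //= (Bout a).1 eqxx mul1r.
rewrite big1 ?addr0 => [|j ja]; last first.
  by rewrite (Bout j).2 eq_sym (negPf ja) mul0r.
rewrite !expand_cofactor; apply: eq_bigr => s /eqP sa; congr (_ * _).
apply: eq_bigr => k ak; rewrite Bin 1?eq_sym //.
by rewrite -[X in X != _]sa (inj_eq perm_inj).
Qed.

Definition mask (N : {set 'I_n}) M : 'M[R]_n :=
  \matrix_(a, b) if (a \in N) && (b \in N) then M a b else (a == b)%:R.

Definition cauchy_mx (g : 'I_n -> 'I_n -> R) (x : 'I_n -> R) : 'M[R]_n :=
  \matrix_(a, b) if a == b then x a else - g a b.

Lemma mask_bordered N M a : a \in N -> bordered (mask N M) (mask (N :\ a) M) a.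
Proof.
move=> aN; split=> [i j ia ja|i]; rewrite !mxE ?setD1P !inE ?ia ?ja //.
by rewrite !eqxx andbF.
Qed.

Lemma cofactor_mask N M c : c \in N ->
  cofactor (mask N M) c c = \det (mask (N :\ c) M).
Proof.
move=> cN; have [Bin Bout] := mask_bordered M cN.
rewrite (expand_det_row _ c) (bigD1 c) //= (Bout c).1 eqxx mul1r.
rewrite [X in _ = _ + X]big1 ?addr0 => [|j jc]; last first.
  by rewrite (Bout j).2 eq_sym (negPf jc) mul0r.
rewrite !expand_cofactor; apply: eq_bigr => s /eqP sc; congr (_ * _).
apply: eq_bigr => k ck; rewrite Bin 1?eq_sym //.
by rewrite -[X in X != _]sc (inj_eq perm_inj).
Qed.

Lemma det_mask0 M : \det (mask set0 M) = 1.
Proof.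
rewrite -(det1 R n); congr (\det _); apply/matrixP => i j.
by rewrite !mxE inE.
Qed.

(** With [det_bordered], the terms c = c' are the squares on the right. The terms
    c <> c' cancel: the hypothesis on products writes each as a difference, in
    which g c c' is an entry of the minor B, and both halves sum to
    sum_c g a c * (det B - B c c * cofactor B c c), once by columns and once by
    rows. *)
Lemma det_cauchy_rec (g : 'I_n -> 'I_n -> R) x (N : {set 'I_n}) a :
    (forall b c, g b c = - g c b) ->
    (forall b c d, b != c -> b != d -> c != d ->
       g b c * g b d = (g b c - g b d) * g c d) ->
    a \in N ->
  \det (mask N (cauchy_mx g x)) =
    x a * \det (mask (N :\ a) (cauchy_mx g x)) +
    \sum_(c in N :\ a) g a c ^+ 2 * \det (mask (N :\ a :\ c) (cauchy_mx g x)).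
Proof.
move=> gN g3 aN; set L := cauchy_mx g x.
rewrite (det_bordered (mask_bordered L aN)) 2!mxE aN eqxx /=; congr (_ + _).
set B := mask (N :\ a) L.
have Bout i j : j \notin N :\ a -> B i j = (i == j)%:R.
  by move=> jN; rewrite !mxE (negPf jN) andbF.
have row i : i \in N :\ a -> \sum_(j in N :\ a) B i j * cofactor B i j = \det B.
  move=> iN; rewrite (expand_det_row B i) [RHS](bigID (mem (N :\ a))) /=.
  rewrite [X in _ = _ + X]big1 ?addr0 // => j jN.
  by rewrite Bout //; case: eqP jN => [<-|]; rewrite ?iN // mul0r.
have col j : j \in N :\ a -> \sum_(i in N :\ a) B i j * cofactor B i j = \det B.
  move=> jN; rewrite (expand_det_col B j) [RHS](bigID (mem (N :\ a))) /=.
  rewrite [X in _ = _ + X]big1 ?addr0 // => i iN.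
  by rewrite mxE (negPf iN) /=; case: eqP iN => [->|]; rewrite ?jN // mul0r.
have red : \sum_(c | c != a) \sum_(c' | c' != a)
      mask N L a c * mask N L c' a * cofactor B c' c =
    - \sum_(c in N :\ a) \sum_(c' in N :\ a) g a c * g a c' * cofactor B c' c.
  rewrite -sumrN (bigID (mem N)) /= [X in _ + X]big1 ?addr0.
    apply: eq_big => [c|c /andP[ca cN]]; first by rewrite !inE.
    rewrite -sumrN (bigID (mem N)) /= [X in _ + X]big1 ?addr0.
      apply: eq_big => [c'|c' /andP[c'a c'N]]; first by rewrite !inE.
      rewrite !mxE aN cN c'N /= eq_sym (negPf ca) (negPf c'a).
      by rewrite [g c' a]gN opprK mulNr mulNr.
    move=> c' /andP[c'a c'N]; rewrite [mask N L c' a]mxE (negPf c'N) /=.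
    by rewrite (negPf c'a) mulr0 mul0r.
  move=> c /andP[ca cN]; apply: big1 => c' _.
  by rewrite mxE (negPf cN) andbF eq_sym (negPf ca) !mul0r.
rewrite {}red opprK.
have off : \sum_(c in N :\ a) \sum_(c' in N :\ a | c' != c)
    g a c * g a c' * cofactor B c' c = 0.
  transitivity (\sum_(c in N :\ a) \sum_(c' in N :\ a | c' != c)
    g a c * (B c' c * cofactor B c' c) -
    \sum_(c in N :\ a) \sum_(c' in N :\ a | c' != c)
    g a c' * (B c' c * cofactor B c' c)).
    rewrite -sumrB; apply: eq_bigr => c cN; rewrite -sumrB.
    apply: eq_bigr => c' /andP[c'N cc']; rewrite -mulrBl [RHS]mulrA.
    move: (cN) (c'N); rewrite !inE => /andP[ca cN'] /andP[c'a c'N'].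
    rewrite g3 1?eq_sym // 1?eq_sym //; congr (_ * _ * _).
    by rewrite !mxE cN c'N (negPf cc') /= gN.
  apply/eqP; rewrite subr_eq0; apply/eqP.
  transitivity (\sum_(c in N :\ a) g a c * (\det B - B c c * cofactor B c c)).
    apply: eq_bigr => c cN; rewrite -mulr_sumr; congr (_ * _).
    by apply/eqP; rewrite eq_sym subr_eq addrC -(col c cN) (bigD1 c).
  rewrite (exchange_big_dep (mem (N :\ a))) //=; last by move=> i j _ /andP[].
  apply: eq_bigr => c cN; rewrite -mulr_sumr; congr (_ * _).
  apply/eqP; rewrite subr_eq addrC -(row c cN) (bigD1 c) //=; apply/eqP.
  congr (_ + _); by apply: eq_bigl => j; rewrite eq_sym cN.
transitivity (\sum_(c in N :\ a) (g a c ^+ 2 * cofactor B c c +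
   \sum_(c' in N :\ a | c' != c) g a c * g a c' * cofactor B c' c)).
  by apply: eq_bigr => c cN; rewrite (bigD1 c) //= expr2.
rewrite big_split /= off addr0; apply: eq_bigr => c cN.
by rewrite cofactor_mask.
Qed.

End BorderedDet.

(** * The matching polynomial *)

Section Upd.
Variables (I : eqType) (T : Type).
Definition upd (x : I -> T) (b : I) (t : T) (a : I) := if a == b then t else x a.
Lemma updE x b t : upd x b t b = t. Proof. by rewrite /upd eqxx. Qed.
Lemma updN x b t a : a != b -> upd x b t a = x a.
Proof. by rewrite /upd => /negPf->. Qed.
End Upd.

(** Products here are ordered, so changing the factor at b acts between a left
    part l and a right part r; an element that commutes with the other factors
    can be moved across l. *)
Lemma prod_upd_split (I : finType) (B : pzSemiRingType) (T : {set I})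
    (x : I -> B) (b : I) : b \in T ->
  exists l r, [/\ forall t, \prod_(a in T) upd x b t a = l * t * r,
    \prod_(a in T :\ b) x a = l * r
  & forall e, {in T :\ b, forall a, GRing.comm e (x a)} -> GRing.comm e l].
Proof.
pose e (S : {set I}) := [seq a <- index_enum I | a \in S].
have mem_e (S : {set I}) a : (a \in e S) = (a \in S).
  by rewrite mem_filter mem_index_enum andbT.
have prod_e (S : {set I}) (y : I -> B) : \prod_(a in S) y a = \prod_(a <- e S) y a.
  by rewrite big_filter.
rewrite -mem_e => bT.
have: uniq (e T) by rewrite filter_uniq // index_enum_uniq.
move Dr: (e T) bT => r bT Ur; case/splitPr: bT Ur Dr => r1 r2 Ur Dr.
have Db: e (T :\ b) = r1 ++ r2.
  have ->: e (T :\ b) = filter (predC1 b) (e T).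
    by rewrite -filter_predI; apply: eq_filter => a; rewrite !inE.
  rewrite Dr; move: Ur; rewrite cat_uniq /= => /and3P[_].
  rewrite negb_or => /andP[br1 _] /andP[br2 _].
  rewrite filter_cat /= eqxx /=.
  by congr (_ ++ _); apply/all_filterP/allP => a; apply: contraTneq => ->.
have updr (r' : seq I) t : {subset r' <= r1 ++ r2} ->
    \prod_(a <- r') upd x b t a = \prod_(a <- r') x a.
  move=> r'r; apply: eq_big_seq => a /r'r; rewrite -Db mem_e.
  by move=> /setD1P[ab _]; apply: updN.
have r1s : {subset r1 <= r1 ++ r2} by move=> a; rewrite mem_cat => ->.
have r2s : {subset r2 <= r1 ++ r2} by move=> a; rewrite mem_cat orbC => ->.
exists (\prod_(a <- r1) x a), (\prod_(a <- r2) x a); split=> [t||y xy].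
- by rewrite prod_e Dr big_cat big_cons /= mulrA updE !updr.
- by rewrite prod_e Db big_cat.
rewrite big_seq; apply: commr_prod => a /r1s.
by rewrite -Db mem_e; apply: xy.
Qed.

Lemma prod_upd_out (I : finType) (B : pzSemiRingType) (T : {set I})
    (x : I -> B) (b : I) t : b \notin T ->
  \prod_(a in T) upd x b t a = \prod_(a in T) x a.
Proof.
move=> bT; apply: eq_bigr => a aT; rewrite updN //.
by apply: contraTneq aT => ->.
Qed.

Lemma sum_subsets_setD1 (V : nmodType) (T : finType) (N : {set T}) b
    (f : {set T} -> V) : b \in N ->
  \sum_(S : {set T} | S \subset N) f S =
  \sum_(S : {set T} | S \subset N :\ b) f S +
  \sum_(S : {set T} | S \subset N :\ b) f (b |: S).
Proof.
move=> bN; rewrite (bigID (fun S : {set T} => b \notin S)) /=; congr (_ + _).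
  by apply: eq_bigl => S; rewrite subsetD1.
rewrite (reindex_onto (fun S => b |: S) (fun S => S :\ b)) /=; last first.
  by move=> S /andP[_ /negPn bS]; rewrite setD1K.
apply: eq_bigl => S; rewrite subUset sub1set bN setU11 subsetD1 andbT /=.
congr (_ && _); apply/eqP/idP => [<-|bS]; last by rewrite setU1K.
by rewrite !inE eqxx.
Qed.

Section MatchPoly.
Variables (F : fieldType) (n : nat) (z : 'I_n -> F).
Hypothesis z_inj : injective z.
Implicit Types (N S T : {set 'I_n}) (a b c : 'I_n).

Definition gap a b : F := (z a - z b)^-1.

Lemma gapN a b : gap a b = - gap b a.
Proof. by rewrite /gap -invrN opprB. Qed.

Lemma gap_telescope a b c : a != b -> a != c -> b != c ->
  gap a b * gap a c = (gap a b - gap a c) * gap b c.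
Proof.
have nz i j : i != j -> z i - z j != 0 by rewrite subr_eq0 (inj_eq z_inj).
move=> /nz ab /nz ac /nz bc; rewrite /gap.
field.
by rewrite -oppr_eq0 opprB ac -oppr_eq0 opprB ab bc.
Qed.

(** The weighted number of perfect matchings of S, the pair {a, b} having weight
    (z_a - z_b)^(-2): this is the content of [match_coef_rec]. *)
Definition match_coef S : F := \det (mask S (cauchy_mx gap (fun=> 0))).

(** The sum over the matchings of N: T is the set of unmatched points. The
    product over T is taken in increasing order, which matters when the x a do
    not commute. Keeping it well defined and affine in each x a for
    noncommuting entries is what makes partial fractions available later. *)
Definition match_poly (B : algType F) N (x : 'I_n -> B) : B :=
  \sum_(T : {set 'I_n} | T \subset N) match_coef (N :\: T) *: \prod_(a in T) x a.

Lemma match_coef0 : match_coef set0 = 1.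
Proof. exact: det_mask0. Qed.

Lemma match_coef_rec S a : a \in S ->
  match_coef S = \sum_(c in S :\ a) gap a c ^+ 2 * match_coef (S :\ a :\ c).
Proof.
move=> aS; rewrite /match_coef (det_cauchy_rec _ _ _ aS) ?mul0r ?add0r //.
  exact: gapN.
exact: gap_telescope.
Qed.

Section Algebra.
Variable B : algType F.
Implicit Types (x y : 'I_n -> B).

Lemma eq_match_poly N x y : {in N, x =1 y} -> match_poly N x = match_poly N y.
Proof.
move=> xy; apply: eq_bigr => T TN; congr (_ *: _).
by apply: eq_bigr => a aT; apply/xy/(subsetP TN).
Qed.

Lemma match_poly0 x : match_poly set0 x = 1.
Proof.
rewrite /match_poly (big_pred1 set0) => [|T]; last by rewrite subset0.
by rewrite set0D match_coef0 big_set0 scale1r.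
Qed.

Lemma match_poly_upd N x b q e : b \in N ->
    {in N :\ b, forall a, GRing.comm e (x a)} ->
  match_poly N (upd x b (q + e)) = match_poly N (upd x b q) + e * match_poly (N :\ b) x.
Proof.
move=> bN ex; rewrite /match_poly !(sum_subsets_setD1 _ bN) -addrA.
congr (_ + _).
  apply: eq_bigr => T; rewrite subsetD1 => /andP[_ bT].
  by rewrite !prod_upd_out.
rewrite mulr_sumr -big_split; apply: eq_bigr => T; rewrite subsetD1 => /andP[TN bT] /=.
rewrite -setDDl -scalerAr -scalerDr -[in X in e * X](setU1K bT); congr (_ *: _).
have [l [r [E1 -> lP]]] := prod_upd_split x (setU11 b T).
rewrite !E1 mulrDr mulrDl [e * _]mulrA (lP e) // => a.
rewrite setU1K // => aT; apply/ex/setD1P; split; last exact: (subsetP TN).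
by apply: contraNneq bT => <-.
Qed.

(** With x b = 0 the point b has to be matched to some c. *)
Lemma match_poly_upd0 N x b : b \in N ->
  match_poly N (upd x b 0) =
  \sum_(c in N :\ b) gap b c ^+ 2 *: match_poly (N :\ b :\ c) x.
Proof.
move=> bN; rewrite /match_poly (bigID (fun T : {set 'I_n} => b \in T)) /=.
rewrite big1 ?add0r => [|T /andP[_ bT]]; last first.
  have [l [r [-> _ _]]] := prod_upd_split x bT.
  by rewrite mulr0 mul0r scaler0.
transitivity (\sum_(T : {set 'I_n} | T \subset N :\ b)
    \sum_(c in N :\ b | c \notin T)
      (gap b c ^+ 2 * match_coef (N :\ b :\ c :\: T)) *: \prod_(a in T) x a).
  apply: eq_big => [T|T /andP[TN bT]]; first by rewrite subsetD1.
  have bNT : b \in N :\: T by rewrite inE bT.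
  rewrite prod_upd_out // (match_coef_rec bNT) scaler_suml.
  apply: eq_big => [c|c _]; first by rewrite !inE andbA andbAC.
  by rewrite !setDDl [T :|: _]setUC -setUA.
rewrite (exchange_big_dep (mem (N :\ b))) => [|T c _ /andP[] //] /=.
apply: eq_bigr => c cN; rewrite scaler_sumr.
apply: eq_big => [T|T _]; last by rewrite scalerA.
by rewrite [RHS]subsetD1 cN.
Qed.

Lemma match_poly_affine N x b p e t : b \in N ->
  match_poly N (upd x b (p + t *: e)) = match_poly N (upd x b p) +
    t *: (match_poly N (upd x b (p + e)) - match_poly N (upd x b p)).
Proof.
move=> bN; rewrite -sumrB scaler_sumr -big_split; apply: eq_bigr => T TN /=.
have [bT|bT] := boolP (b \in T); last first.
  by rewrite !prod_upd_out // subrr scaler0 addr0.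
rewrite -scalerBr [t *: (_ *: _)]scalerA mulrC -[X in _ = _ + X]scalerA -scalerDr.
congr (_ *: _).
have [l [r [E1 _ _]]] := prod_upd_split x bT.
rewrite !E1 !mulrDr !mulrDl addrAC subrr add0r.
by rewrite -scalerAr -scalerAl.
Qed.

Lemma match_poly_rec N x b : b \in N ->
    {in N :\ b, forall a, GRing.comm (x b) (x a)} ->
  match_poly N x = x b * match_poly (N :\ b) x +
    \sum_(c in N :\ b) gap b c ^+ 2 *: match_poly (N :\ b :\ c) x.
Proof.
move=> bN xb; rewrite -match_poly_upd0 // addrC -match_poly_upd // add0r.
by apply: eq_match_poly => a _; rewrite /upd; case: eqP => [->|].
Qed.

End Algebra.

Lemma match_poly_det (B : comAlgType F) N (x : 'I_n -> B) :
  match_poly N x = \det (mask N (cauchy_mx (fun a b => (gap a b)%:A) x)).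
Proof.
have [m] := ubnP #|N|; elim: m N => // m IH N /ltnSE Nm.
have [->|[b bN]] := set_0Vmem N; first by rewrite match_poly0 det_mask0.
have Nb : (#|N :\ b| < m)%N.
  by apply: leq_trans Nm; rewrite [X in (_ < X)%N](cardsD1 b) bN.
rewrite (match_poly_rec bN) => [|a _]; last exact: mulrC.
rewrite (det_cauchy_rec _ _ _ bN) => [|a c|a c d ac ad cd].
- rewrite (IH _ Nb); congr (_ + _); apply: eq_bigr => c cN.
  rewrite (IH (N :\ b :\ c)); last first.
    by apply: leq_trans Nb; rewrite ltnS subset_leq_card // subD1set.
  by rewrite exprZn expr1n -scalerAl mul1r.
- by rewrite gapN scaleNr.
- by rewrite -scalerBl -!scalerAl !mul1r !scalerA gap_telescope // mulrC.
Qed.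

End MatchPoly.

(** * Partial fractions of multiaffine functions *)

Section Multiaffine.
Variables (F : fieldType) (I : finType).
Implicit Types (N : {set I}) (d : I -> F).

(** An affine function of one variable is determined by its values at 0 and 1.
    Stated in this way, the closure properties need no expansion in monomials. *)
Definition multiaffine (V : lmodType F) N (G : (I -> F) -> V) :=
  (forall d d', {in N, d =1 d'} -> G d = G d') /\
  (forall b d t, b \in N ->
     G (upd d b t) = G (upd d b 0) + t *: (G (upd d b 1) - G (upd d b 0))).

Section Closure.
Variable V : lmodType F.
Implicit Types G : (I -> F) -> V.

Lemma multiaffineS N N' G : N \subset N' -> multiaffine N G -> multiaffine N' G.
Proof.
move=> NN' [E L]; split=> [d d' dd'|b d t bN'].
  by apply: E => a /(subsetP NN'); apply: dd'.
have [/L->//|bN] := boolP (b \in N).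
have U s : G (upd d b s) = G d.
  by apply: E => a aN; rewrite updN //; apply: contraNneq bN => <-.
by rewrite !U subrr scaler0 addr0.
Qed.

Lemma multiaffineD N G G' : multiaffine N G -> multiaffine N G' ->
  multiaffine N (fun d => G d + G' d).
Proof.
move=> [E L] [E' L']; split=> [d d' dd'|b d t bN]; first by rewrite (E d d') ?(E' d d').
rewrite (L b d t) // (L' b d t) // addrACA -scalerDr opprD.
by congr (_ + _ *: _); rewrite addrACA.
Qed.

Lemma multiaffine_lin (W : lmodType F) (f : V -> W) N G : linear f ->
  multiaffine N G -> multiaffine N (fun d => f (G d)).
Proof.
move=> fL [E L]; split=> [d d' dd'|b d t bN]; first by rewrite (E d d').
by rewrite (L b d t) // addrC fL addrC -scaleN1r [_ + -1 *: _]addrC fL scaleN1r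
  [- _ + _]addrC.
Qed.

Lemma multiaffine_sum (J : Type) (r : seq J) (P : pred J) N (G : J -> (I -> F) -> V) :
  (forall j, P j -> multiaffine N (G j)) ->
  multiaffine N (fun d => \sum_(j <- r | P j) G j d).
Proof.
move=> GN; split=> [d d' dd'|b d t bN].
  by apply: eq_bigr => j /GN[E _]; apply: E.
rewrite -sumrB scaler_sumr -big_split; apply: eq_bigr => j /GN[_ L] /=.
exact: L.
Qed.

Lemma multiaffine_scale c N G : c \notin N -> multiaffine N G ->
  multiaffine (c |: N) (fun d => d c *: G d).
Proof.
move=> cN [E L]; split=> [d d' dd'|b d t].
  by rewrite dd' ?setU11 // (E d d') // => a aN; rewrite dd' // setU1r.
rewrite !inE => /predU1P[->|bN].
  rewrite !updE scale0r add0r subr0 scale1r; congr (_ *: _); apply: E => a aN.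
  by rewrite !updN //; apply: contraNneq cN => <-.
have cb : c != b by apply: contraNneq cN => ->.
rewrite !updN // (L b d t) //.
by rewrite scalerDr !scalerA -scalerBr scalerA mulrC.
Qed.

End Closure.

Variables (z : I -> F).
Hypothesis z_inj : injective z.

Definition pole (u : F) (a : I) : F := (u - z a)^-1.

(** The partial fraction decomposition of 1 / ((u - z_a) (u - z_b)). *)
Lemma poleM u a b : u != z a -> u != z b -> a != b ->
  pole u a * pole u b = pole u a * pole (z a) b + pole u b * pole (z b) a.
Proof.
rewrite /pole -(inj_eq z_inj) => ua ub ab; field.
by rewrite !subr_eq0 ua ub ab eq_sym ab.
Qed.

(** Substituting the poles 1 / (u - z_a) in a multiaffine function gives simple
    poles at the z_b. The residue there is the derivative in the variable b,
    i.e. the difference of the values at 1 and 0, with u = z_b in the other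
    variables; G (fun=> 0) is the value at infinity. Induction on N: separate one
    variable a and use [poleM]. *)
Lemma multiaffine_partial_fractions (V : lmodType F) N (G : (I -> F) -> V) u :
    multiaffine N G -> {in N, forall a, u != z a} ->
  G (pole u) = G (fun=> 0) + \sum_(b in N)
     pole u b *: (G (upd (pole (z b)) b 1) - G (upd (pole (z b)) b 0)).
Proof.
have [m] := ubnP #|N|; elim: m N G u => // m IH N G u /ltnSE Nm [E L] uN.
have [N0|[a aN]] := set_0Vmem N.
  by rewrite N0 big_set0 addr0; apply: E => b; rewrite N0 inE.
have Na : (#|N :\ a| < m)%N.
  by apply: leq_trans Nm; rewrite [X in (_ < X)%N](cardsD1 a) aN.
have updC d b s s' : b != a ->
    {in N, upd (upd d b s) a s' =1 upd (upd d a s') b s}.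
  move=> ba c _; rewrite /upd; case: eqP => [->|//].
  by rewrite eq_sym (negPf ba).
have extG s : multiaffine (N :\ a) (fun d => G (upd d a s)).
  split=> [d d' dd'|b d t].
    apply: E => b bN; rewrite /upd; case: eqP => // /eqP ba.
    by apply: dd'; rewrite !inE ba.
  rewrite !inE => /andP[ba bN].
  by rewrite !(E _ _ (updC d b _ s ba)) (L b).
set G0 := fun d => G (upd d a 0).
set G1 := fun d => G (upd d a 1) - G (upd d a 0).
have mG0 : multiaffine (N :\ a) G0 by apply: extG.
have mG1 : multiaffine (N :\ a) G1.
  apply: multiaffineD (extG 1) _.
  by apply: multiaffine_lin (extG 0) => k v w; rewrite opprD scalerN.
have GE d : G d = G0 d + d a *: G1 d.
  rewrite -L //; apply: E => b _; rewrite /upd.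
  by case: eqP => [->|].
have zN : {in N :\ a, forall b, z a != z b}.
  by move=> b; rewrite !inE => /andP[ba _]; rewrite (inj_eq z_inj) eq_sym.
have uNa : {in N :\ a, forall b, u != z b}.
  by move=> b /setD1P[_]; apply: uN.
rewrite [LHS]GE (IH _ _ _ Na mG0 uNa) (IH _ _ _ Na mG1 uNa).
rewrite (big_setD1 a aN) /=.
have <- : G1 (pole (z a)) = G (upd (pole (z a)) a 1) - G (upd (pole (z a)) a 0) by [].
rewrite (IH _ _ _ Na mG1 zN).
have -> : G0 (fun=> 0) = G (fun=> 0).
  by apply: E => b _; rewrite /upd; case: eqP.
rewrite !scalerDr -!addrA; congr (_ + _).
do 2![rewrite [LHS]addrCA; congr (_ + _)].
rewrite !scaler_sumr -!big_split; apply: eq_bigr => b bN /=.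
have /setD1P[ba bN'] := bN.
have ua : u != z a by apply: uN.
have ub : u != z b by apply: uN.
rewrite !scalerA poleM // 1?eq_sym // scalerDl addrCA; congr (_ + _).
rewrite -scalerA -scalerDr; congr (_ *: _).
rewrite [G (upd _ b 1)]GE [G (upd _ b 0)]GE !updN 1?eq_sym //.
by rewrite scalerBr [in RHS]opprD [RHS]addrACA.
Qed.

End Multiaffine.

Lemma multiaffine_match_poly (F : fieldType) n (z : 'I_n -> F) (B : algType F)
    (N : {set 'I_n}) (y e : 'I_n -> B) :
  multiaffine N (fun d => match_poly z N (fun c => y c + d c *: e c)).
Proof.
split=> [d d' dd'|b d t bN].
  by apply: eq_match_poly => a aN; rewrite dd'.
have U s : match_poly z N (fun c => y c + upd d b s c *: e c) =
    match_poly z N (upd (fun c => y c + d c *: e c) b (y b + s *: e b)).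
  by apply: eq_match_poly => a aN; rewrite /upd; case: eqP => [->|].
by rewrite !U match_poly_affine // scale0r addr0 scale1r.
Qed.

(** * KZ elements and transpositions *)

Section Transpositions.
Variables (F : fieldType) (n : nat).
Local Notation A := (galg F 'S_n).
Implicit Types (a b c d : 'I_n) (N K X : {set 'I_n}).
Local Notation sw a b := (gelt F (tperm a b)).

Lemma swC a b : sw a b = sw b a. Proof. by rewrite tpermC. Qed.

Lemma swK a b : sw a b * sw a b = 1.
Proof. by rewrite -geltM tperm2. Qed.

Lemma sw_tri a b c : a != c -> b != c -> sw a c * sw a b = sw a b * sw b c.
Proof.
by move=> ac bc; rewrite -!geltM -(tpermJ_tperm ac bc) conjgC.
Qed.

Lemma sw_disj a b c d : a != c -> a != d -> b != c -> b != d ->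
  GRing.comm (sw a b) (sw c d).
Proof.
move=> ac ad bc bd; rewrite /GRing.comm -!geltM; congr gelt.
by rewrite [RHS]conjgC tpermJ !tpermD.
Qed.

Section Commutator.
Variable B : algType F.
Implicit Types x y : B.
Definition commutator x y := x * y - y * x.
Lemma commutatorDl x y t : commutator (x + y) t = commutator x t + commutator y t.
Proof. by rewrite /commutator mulrDl mulrDr opprD addrACA. Qed.
Lemma commutatorDr x y t : commutator t (x + y) = commutator t x + commutator t y.
Proof. by rewrite /commutator mulrDl mulrDr opprD addrACA. Qed.
Lemma commutatorZl k x y : commutator (k *: x) y = k *: commutator x y.
Proof. by rewrite /commutator scalerBr scalerAl scalerAr. Qed.
Lemma commutatorZr k x y : commutator x (k *: y) = k *: commutator x y.
Proof. by rewrite /commutator scalerBr -scalerAl -scalerAr. Qed.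
Lemma commutatorxx x : commutator x x = 0. Proof. by rewrite /commutator subrr. Qed.
Lemma commutator_sym x y : commutator x y = - commutator y x.
Proof. by rewrite /commutator opprB. Qed.
Lemma commutator_suml (J : Type) (r : seq J) (P : pred J) (f : J -> B) x :
  commutator (\sum_(j <- r | P j) f j) x = \sum_(j <- r | P j) commutator (f j) x.
Proof. by rewrite /commutator mulr_suml mulr_sumr -sumrB. Qed.
Lemma commutator_sumr (J : Type) (r : seq J) (P : pred J) (f : J -> B) x :
  commutator x (\sum_(j <- r | P j) f j) = \sum_(j <- r | P j) commutator x (f j).
Proof. by rewrite /commutator mulr_suml mulr_sumr -sumrB. Qed.
Lemma commutator0P x y : commutator x y = 0 <-> GRing.comm x y.
Proof. by split=> [/eqP|c]; rewrite /commutator ?c ?subrr // subr_eq0 => /eqP. Qed.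
End Commutator.

(** The sites are the points of X, and zeta gives their positions. *)
Definition kz (zeta : 'I_n -> F) X a : A :=
  \sum_(b in X | b != a) gap zeta a b *: sw a b.

Lemma kz_setD1 zeta X a b : b \in X -> a != b ->
  kz zeta X a = gap zeta a b *: sw a b + kz zeta (X :\ b) a.
Proof.
move=> bX ab; rewrite /kz (bigD1 b) /= ?bX 1?eq_sym //; congr (_ + _).
by apply: eq_bigl => c; rewrite !inE; case: eqP; case: (c \in X); case: eqP.
Qed.

(** The two 3-cycles on {a, b, c}, each written as a product of transpositions in
    three ways. *)
Lemma sw_triangle a b c : a != b -> a != c -> b != c ->
  [/\ sw a c * sw a b = sw a b * sw b c, sw b c * sw a c = sw a b * sw b c,
      sw a b * sw a c = sw b c * sw a b & sw a c * sw b c = sw b c * sw a b].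
Proof.
move=> ab ac bc; have [ba ca cb] : [/\ b != a, c != a & c != b].
  by rewrite ![_ == a]eq_sym [c == b]eq_sym.
rewrite (sw_tri ac bc) [sw a c]swC -(sw_tri ba ca) [sw b a]swC.
split=> //; first by rewrite [sw c a]swC (swC a b) -(sw_tri bc ac) swC.
by rewrite [sw b c]swC (sw_tri ca ba) [sw b a]swC.
Qed.

(** Flatness of the KZ connection. A third site c contributes the difference of
    the two 3-cycles on {a, b, c}, with a coefficient that vanishes by the
    partial fraction identity for the three gaps. Positions of other sites may
    coincide, which is used for fused sites. *)
Lemma kz_comm zeta X a b : a \in X -> b \in X ->
    {in X, forall c, c != a -> zeta a != zeta c} ->
    {in X, forall c, c != b -> zeta b != zeta c} ->
  GRing.comm (kz zeta X a) (kz zeta X b).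
Proof.
move=> aX bX za zb; have [->//|ab] := eqVneq a b; apply/commutator0P.
rewrite (kz_setD1 zeta bX ab) (kz_setD1 zeta aX) 1?eq_sym //.
rewrite commutatorDl !commutatorDr !commutatorZl !commutatorZr (swC b a).
rewrite commutatorxx !scaler0 add0r.
rewrite [commutator _ (sw a b)]commutator_sym /kz.
rewrite commutator_suml !commutator_sumr scalerN !scaler_sumr.
rewrite -!sumrN.
have XE c : (c \in X :\ a) && (c != b) = (c \in X :\ b) && (c != a).
  by rewrite !inE; case: eqP; case: (c \in X); case: eqP.
rewrite (eq_bigl _ _ XE) -!big_split /=.
rewrite -[RHS](@big1_eq _ 0 +%R _ (index_enum _) (fun c => (c \in X :\ b) && (c != a))).
apply: eq_bigr => c; rewrite !inE => /andP[/andP[cb cX] ca].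
have [ac bc] : a != c /\ b != c by rewrite ![_ == c]eq_sym.
have [T1 T2 T3 T4] := sw_triangle ab ac bc.
rewrite commutator_sumr (bigD1 c) /=; last by rewrite !inE ca cb cX.
rewrite [X in _ + (_ + (_ + X))]big1 ?addr0 => [|d]; last first.
  rewrite !inE => /andP[/andP[/andP[da dX] db] dc].
  rewrite commutatorZl commutatorZr (_ : commutator _ _ = 0) ?scaler0 //.
  by apply/commutator0P/sw_disj; rewrite // eq_sym.
rewrite !commutatorZl !commutatorZr /commutator T1 T2 T3 T4 -[sw b c * _ - _]opprB.
rewrite !scalerA !scalerN opprK -scalerBl -scalerDl.
apply/eqP; rewrite scaler_eq0; apply/orP; left; apply/eqP; rewrite /gap; field.
rewrite !subr_eq0 [zeta b == zeta a]eq_sym.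
by rewrite (za b) ?(za c) ?(zb c) // eq_sym.
Qed.

Definition swap_sum K c : A := \sum_(k in K) sw k c.

(** Fusion: the sites of K all sit at u, and interact with c only through the sum
    of the transpositions. *)
Lemma kz_fused (z : 'I_n -> F) N K u c : [disjoint N & K] -> c \in N ->
  kz (fun a => if a \in K then u else z a) (N :|: K) c =
  kz z N c - pole z u c *: swap_sum K c.
Proof.
move=> NK cN; have cK : c \notin K by rewrite (disjointFr NK).
rewrite /kz (bigID (mem K)) /= addrC; congr (_ + _).
  apply: eq_big => [b|b]; rewrite ?inE /gap.
    have [bK|bK] := boolP (b \in K); rewrite ?andbF ?andbT ?orbF //.
    by rewrite (disjointFl NK).
  by move=> /andP[_ bK]; rewrite (negPf cK) (negPf bK).
rewrite scaler_sumr -sumrN; apply: eq_big => [b|b].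
  rewrite !inE; have [bK|bK] := boolP (b \in K); rewrite ?andbF // orbT andbT.
  by apply: contraNneq cK => <-.
move=> /andP[_ bK]; rewrite /gap bK (negPf cK) /pole -scaleNr -invrN opprB.
by rewrite swC.
Qed.

Lemma kz_fused_comm (z : 'I_n -> F) N K u a b : injective z ->
    [disjoint N & K] -> {in N, forall c, u != z c} -> a \in N -> b \in N ->
  GRing.comm (kz z N a - pole z u a *: swap_sum K a)
             (kz z N b - pole z u b *: swap_sum K b).
Proof.
move=> z_inj NK uN aN bN; rewrite -!kz_fused //.
have sep c : c \in N -> {in N :|: K, forall d, d != c ->
    (if c \in K then u else z c) != (if d \in K then u else z d)}.
  move=> cN d _ dc; rewrite (disjointFr NK cN).
  by case: ifP => _; rewrite 1?eq_sym ?uN // (inj_eq z_inj) // eq_sym.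
by apply: kz_comm; rewrite ?inE ?aN ?bN //; apply: sep.
Qed.

Lemma swap_sum_comm_kz (z : 'I_n -> F) N K b c :
    b \notin N -> b \notin K -> [disjoint N & K] -> c \in N ->
  GRing.comm (swap_sum K b) (kz z N c).
Proof.
move=> bN bK NK cN; apply/commutator0P; rewrite commutator_suml big1 // => k kK.
rewrite commutator_sumr big1 // => d /andP[dN dc]; rewrite commutatorZr.
rewrite (_ : commutator _ _ = 0) ?scaler0 //; apply/commutator0P/sw_disj.
- by apply: contraTneq cN => <-; rewrite (disjointFl NK).
- by apply: contraTneq dN => <-; rewrite (disjointFl NK).
- by apply: contraNneq bN => ->.
- by apply: contraNneq bN => ->.
Qed.

Lemma swap_sum_comm_swap_sum K b c :
    b != c -> b \notin K -> c \notin K ->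
  GRing.comm (swap_sum K b) (sw b c + swap_sum K c).
Proof.
move=> bc bK cK; apply/commutator0P; rewrite commutator_suml big1 // => k kK.
have [kb kc] : k != b /\ k != c.
  by split; [apply: contraNneq bK|apply: contraNneq cK] => <-.
rewrite commutatorDr commutator_sumr (bigD1 k) //= big1 ?addr0 => [|k' /andP[k'K k'k]].
  have [T1 T2 T3 T4] := sw_triangle kb kc bc.
  by rewrite /commutator T1 T3 addrC subrKA subrr.
apply/commutator0P/sw_disj; rewrite // 1?eq_sym //.
  by apply: contraNneq bK => <-.
Qed.

(** The coefficient of the pole at u = z_b commutes with the entry of c after b
    has been fused with K, so it can be moved to the left of the residue. *)
Lemma swap_sum_comm_fused (z : 'I_n -> F) N K b c t :
    b \notin N -> b \notin K -> [disjoint N & K] -> c \in N ->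
  GRing.comm (swap_sum K b) (kz z N c - t *: (sw b c + swap_sum K c)).
Proof.
move=> bN bK NK cN; apply/commutator0P; rewrite -scaleNr commutatorDr commutatorZr.
have/commutator0P-> := swap_sum_comm_kz z bN bK NK cN.
rewrite add0r (_ : commutator _ _ = 0) ?scaler0 //; apply/commutator0P.
apply: swap_sum_comm_swap_sum => //; first by apply: contraNneq bN => ->.
by rewrite (disjointFr NK).
Qed.

End Transpositions.

(** * Nilpotency at the KZ elements *)

Lemma setD1C (T : finType) (S : {set T}) a b : S :\ a :\ b = S :\ b :\ a.
Proof. by rewrite !setDDl setUC. Qed.

Lemma comm_alg_sub (F : fieldType) (B : algType F) (x y : B) (k l : F) : GRing.comm x y ->
  GRing.comm (k%:A - x) (l%:A - y).
Proof.
move=> xy; apply: commrB; first exact/commr_sym/comm_alg.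
by apply/commr_sym/commrB; [exact/commr_sym/comm_alg | exact/commr_sym].
Qed.

Section Pencil.
Variables (F : fieldType) (n : nat) (z : 'I_n -> F) (B : algType F).
Variables (y e : 'I_n -> B).
Implicit Types (N : {set 'I_n}) (p : 'I_n -> F).
(** Entries that depend affinely on parameters p, in practice p = pole u. *)
Definition pencil p c := y c + p c *: e c.

Lemma pencil_upd_out N p b t : b \notin N ->
  match_poly z N (pencil (upd p b t)) = match_poly z N (pencil p).
Proof.
move=> bN; apply: eq_match_poly => c cN; rewrite /pencil updN //.
by apply: contraNneq bN => <-.
Qed.

Lemma pencil_upd_in N p b : b \in N ->
    {in N :\ b, forall c, GRing.comm (e b) (pencil p c)} ->
  match_poly z N (pencil (upd p b 1)) =
  match_poly z N (pencil (upd p b 0)) + e b * match_poly z (N :\ b) (pencil p).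
Proof.
move=> bN ep; have bNb : b \notin N :\ b by rewrite !inE eqxx.
rewrite -(pencil_upd_out p 0 bNb).
transitivity (match_poly z N (upd (pencil (upd p b 0)) b (y b + e b))).
  apply: eq_match_poly => c _; rewrite /pencil /upd; case: eqP => [->|] //.
  by rewrite scale1r.
rewrite match_poly_upd // => [|c /[dup] cN /setD1P[cb _]]; last first.
  by rewrite /pencil updN //; apply: ep.
congr (_ + _); apply: eq_match_poly => c _; rewrite /pencil /upd.
by case: eqP => [->|] //; rewrite scale0r addr0.
Qed.

Lemma pencil_multiaffine N : multiaffine N (fun p => match_poly z N (pencil p)).
Proof. exact: multiaffine_match_poly. Qed.

End Pencil.

Section Vanishing.
Variables (F : fieldType) (n : nat) (z : 'I_n -> F).
Hypothesis z_inj : injective z.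
Local Notation A := (galg F 'S_n).
Implicit Types (a b c d : 'I_n) (N K X : {set 'I_n}).
Local Notation sw a b := (gelt F (tperm a b)).
Local Notation D := (match_poly z (B := A)).
Local Notation g := (gap z).

(** The part of [residue_term] that does not reduce to [match_poly_rec]: the
    3-cycles on {a, b, c} combine to transpositions. *)
Lemma residue_cancel a b c (y : A) (t : F) :
    a != b -> a != c -> b != c -> GRing.comm (sw a b) y ->
  sw a c * sw a b * (y + t *: sw b c + t *: sw a c) =
  t *: sw a b + sw a c * (y + t *: sw b c) * sw a b.
Proof.
move=> ab ac bc yb; have [T1 T2 T3 T4] := sw_triangle F ab ac bc.
rewrite !mulrDr [in RHS]mulrDl -!scalerAr -!scalerAl -!mulrA yb T3.
rewrite [RHS]addrCA addrA.
rewrite (_ : sw a c * (sw a b * sw b c) = sw a b) //.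
by rewrite mulrA T1 -mulrA swK mulr1.
Qed.

(** A site a is added to N, and p stands for the values 1 / (z_a - z_c) as z_a
    moves: [rest_site] is the entry of c without a, [moving_site] the entry with
    a. The function [expanded] is the matching polynomial of a |: N in which the
    double poles have been cancelled: [reduced c] is that of N with the variable
    p c removed from the entry of c, so that [expanded] is multiaffine. *)
Section NewSite.
Variables (N : {set 'I_n}) (a : 'I_n) (v : F).
Hypothesis aN : a \notin N.

Definition rest_site c : A := v%:A - kz z N c.
Definition moving_site (p : 'I_n -> F) c : A := pencil rest_site (fun b => sw a b) p c.
Definition reduced c p : A := rest_site c * D (N :\ c) (moving_site p) +
  \sum_(d in N :\ c) g c d ^+ 2 *: D (N :\ c :\ d) (moving_site p).
Definition expanded p : A :=
  v *: D N (moving_site p) - \sum_(c in N) p c *: (sw a c * reduced c p).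

Lemma moving_siteE p c : moving_site p c = v%:A - (kz z N c - p c *: swap_sum F [set a] c).
Proof. by rewrite /swap_sum big_set1 /moving_site /pencil /rest_site opprB addrA addrAC. Qed.

Lemma site_moving c : c \in N -> v%:A - kz z (a |: N) c = moving_site (g a) c.
Proof.
move=> cN; rewrite (kz_setD1 z (setU11 a N)) ?(memPn aN) // setU1K //.
by rewrite /moving_site /pencil /rest_site gapN scaleNr opprD opprK addrA addrAC swC.
Qed.

Lemma moving_site_comm : {in N &, forall b c,
  GRing.comm (moving_site (g a) b) (moving_site (g a) c)}.
Proof.
move=> b c bN cN; rewrite (moving_siteE _ b) (moving_siteE _ c); apply: comm_alg_sub.
apply: kz_fused_comm => //; first by rewrite disjoint_sym disjoints1.
by move=> d dN; rewrite (inj_eq z_inj) eq_sym (memPn aN).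
Qed.

Lemma match_poly_moving c : c \in N ->
  D N (moving_site (g a)) = reduced c (g a) +
    g a c *: (sw a c * D (N :\ c) (moving_site (g a))).
Proof.
move=> cN; rewrite (match_poly_rec z_inj cN) => [|d /setD1P[dc dN]]; last first.
  exact: moving_site_comm.
by rewrite [X in X * _]/moving_site /pencil mulrDl -scalerAl addrAC.
Qed.

(** Expand at a. The double pole at z_a = z_c comes from (z_a - z_c)^(-2) and
    from the product of the entries of a and c, where the transposition (a c) is
    squared; they cancel. *)
Lemma match_poly_new_site :
  D (a |: N) (fun c => v%:A - kz z (a |: N) c) = expanded (g a).
Proof.
rewrite (match_poly_rec z_inj (setU11 a N)) => [|c cN]; last first.
  have cN' : c \in a |: N by case/setD1P: cN.
  by apply/comm_alg_sub/kz_comm; rewrite ?setU11 // => d _ dc;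
    rewrite (inj_eq z_inj) eq_sym.
rewrite setU1K // (eq_match_poly z site_moving).
rewrite /expanded mulrBl -scalerAl mul1r -addrA; congr (_ + _).
rewrite {1}/kz mulr_suml -sumrN -sumrN.
rewrite (eq_bigl (mem N)); last first.
  by move=> c; rewrite !inE; have [->|] := eqVneq c a; rewrite ?andbT // (negPf aN).
rewrite -big_split; apply: eq_bigr => c cN /=.
rewrite (match_poly_moving cN) mulrDr -!scalerAl -scalerAr mulrA swK mul1r opprD -addrA.
have -> : D (N :\ c) (fun c => v%:A - kz z (a |: N) c) = D (N :\ c) (moving_site (g a)).
  by apply: eq_match_poly => d /setD1P[_]; apply: site_moving.
by rewrite scalerA -expr2 addNr addr0.
Qed.

Lemma multiaffine_reduced c : c \in N -> multiaffine (N :\ c) (reduced c).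
Proof.
move=> cN; apply: multiaffineD.
  apply: (multiaffine_lin (f := *%R (rest_site c))) => [k u w|].
    by rewrite mulrDr scalerAr.
  exact: pencil_multiaffine.
apply: multiaffine_sum => d _.
apply: (multiaffine_lin (f := *:%R (g c d ^+ 2))) => [k u w|].
  by rewrite scalerDr !scalerA mulrC.
by apply: multiaffineS (subD1set _ _) _; apply: pencil_multiaffine.
Qed.

Lemma multiaffine_expanded : multiaffine N expanded.
Proof.
apply: multiaffineD.
  apply: (multiaffine_lin (f := *:%R v)) => [k u w|].
    by rewrite scalerDr !scalerA mulrC.
  exact: pencil_multiaffine.
apply: (multiaffine_lin (f := -%R)) => [k u w|].
  by rewrite opprD scalerN.
apply: multiaffine_sum => c cN.
rewrite -(setD1K cN); apply: multiaffine_scale; first by rewrite !inE eqxx.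
apply: (multiaffine_lin (f := *%R (sw a c))) => [k u w|].
  by rewrite mulrDr scalerAr.
exact: multiaffine_reduced.
Qed.

(** The residue at z_a = z_b. There a and b are fused, and [moving_site] at
    p = pole z (z b) is the entry of c with K = {a, b}. *)
Section Residue.
Variable b : 'I_n.
Hypothesis bN : b \in N.
Local Notation p := (pole z (z b)).
Local Notation M := (N :\ b).

Let ab : a != b. Proof. by apply: contraNneq aN => ->. Qed.
Let bM : b \notin M. Proof. by rewrite !inE eqxx. Qed.
Let aM : a \notin M. Proof. by rewrite inE (negPf aN) andbF. Qed.

Lemma rest_site_residue c : c \in M -> rest_site c = v%:A - kz z M c + g b c *: sw b c.
Proof.
move=> /setD1P[cb cN]; rewrite /rest_site (kz_setD1 z bN) //.
by rewrite gapN scaleNr opprD opprK addrA addrAC swC.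
Qed.

Lemma moving_site_residue c : c \in M ->
  moving_site p c = v%:A - kz z M c + g b c *: sw b c + g b c *: sw a c.
Proof. by move=> cM; rewrite -rest_site_residue. Qed.

Lemma moving_site_fused c : c \in M ->
  moving_site p c = v%:A - (kz z M c - p c *: swap_sum F [set a; b] c).
Proof.
move=> cM; rewrite moving_site_residue // /swap_sum big_setU1 ?inE // big_set1.
by rewrite scalerDr opprD opprK !addrA [RHS]addrAC.
Qed.

Lemma moving_site_fused_comm : {in M &, forall c d,
  GRing.comm (moving_site p c) (moving_site p d)}.
Proof.
move=> c d cM dM; rewrite (moving_site_fused cM) (moving_site_fused dM).
apply/comm_alg_sub/kz_fused_comm => //.
  rewrite -setI_eq0; apply/eqP/setP => i; rewrite !inE.
  by have [->|_] := eqVneq i a; rewrite ?(negPf aN) ?andbF //=; case: eqP; rewrite ?andbF.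
by move=> i /setD1P[ib _]; rewrite (inj_eq z_inj) eq_sym.
Qed.

Lemma sw_moving_site_comm : {in M, forall c, GRing.comm (sw a b) (moving_site p c)}.
Proof.
move=> c cM; rewrite moving_site_fused //; apply: commrB; first exact/commr_sym/comm_alg.
have <- : swap_sum F [set a] b = sw a b by rewrite /swap_sum big_set1.
have -> : swap_sum F [set a; b] c = sw b c + swap_sum F [set a] c.
  by rewrite /swap_sum big_setU1 ?inE // !big_set1 addrC.
apply: swap_sum_comm_fused => //; first by rewrite inE eq_sym.
by rewrite disjoint_sym disjoints1.
Qed.

Lemma moving_upd_in (S : {set 'I_n}) : b \in S -> S \subset N ->
  D S (moving_site (upd p b 1)) =
  D S (moving_site (upd p b 0)) + sw a b * D (S :\ b) (moving_site p).
Proof.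
move=> bS SN; apply: pencil_upd_in => // c /setD1P[cb cS].
by apply: sw_moving_site_comm; rewrite !inE cb (subsetP SN).
Qed.

Lemma moving_upd_out (S : {set 'I_n}) t : b \notin S ->
  D S (moving_site (upd p b t)) = D S (moving_site p).
Proof. exact: pencil_upd_out. Qed.

Lemma reduced_residue c : c \in M ->
  reduced c (upd p b 1) - reduced c (upd p b 0) =
  rest_site c * (sw a b * D (M :\ c) (moving_site p)) +
  sw a b * \sum_(d in M :\ c) g c d ^+ 2 *: D (M :\ c :\ d) (moving_site p).
Proof.
move=> /setD1P[cb cN]; have bNc : b \in N :\ c by rewrite !inE eq_sym cb.
rewrite /reduced moving_upd_in ?subD1set //.
rewrite mulrDr opprD addrACA [_ + _ - _]addrAC subrr add0r.
rewrite setD1C; congr (_ + _); rewrite -sumrB (big_setD1 b) //=.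
rewrite !moving_upd_out ?(setD1C _ c b) ?setD11 ?in_setD1 ?eqxx ?andbF // subrr add0r.
rewrite mulr_sumr; apply: eq_bigr => d; rewrite !inE => /andP[dc /andP[db dN]].
have SE : N :\ c :\ d :\ b = M :\ c :\ d by rewrite (setD1C _ d) (setD1C _ c).
have bS : b \in N :\ c :\ d by rewrite in_setD1 bNc eq_sym db.
have SN : N :\ c :\ d \subset N by rewrite setDDl subsetDl.
by rewrite -scalerBr (moving_upd_in bS SN) addrAC subrr add0r SE scalerAr.
Qed.

(** The contributions of c to the residue. Expanding the left factor at c
    by [match_poly_rec], the sums over d agree, and the rest is
    [residue_cancel]. *)
Lemma residue_term c : c \in M ->
  sw a b * sw b c * D M (moving_site p) - g b c *: (sw a b * D (M :\ c) (moving_site p)) =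
  sw a c * (reduced c (upd p b 1) - reduced c (upd p b 0)).
Proof.
move=> cM; have [ac bc] : a != c /\ b != c.
  by split; apply: contraTneq cM => <-.
have [T1 _ _ _] := sw_triangle F ab ac bc.
have comm0 : GRing.comm (sw a b) (v%:A - kz z M c).
  apply: commrB; first exact/commr_sym/comm_alg.
  have <- : swap_sum F [set a] b = sw a b by rewrite /swap_sum big_set1.
  apply: swap_sum_comm_kz => //; first by rewrite inE eq_sym.
  by rewrite disjoint_sym disjoints1.
rewrite reduced_residue // -T1.
rewrite {1}(match_poly_rec z_inj cM) => [|d /setD1P[_ dM]]; last exact: moving_site_fused_comm.
rewrite mulrDr mulrA moving_site_residue // (residue_cancel _ ab ac bc comm0).
rewrite -rest_site_residue //.
by rewrite mulrDl -scalerAl addrAC [_ + _ - _]addrAC subrr add0r [RHS]mulrDr !mulrA.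
Qed.

Lemma expanded_residue : expanded (upd p b 1) = expanded (upd p b 0).
Proof.
have updE' t : expanded (upd p b t) = v *: D N (moving_site (upd p b t)) -
    (t *: (sw a b * reduced b p) +
     \sum_(c in M) g b c *: (sw a c * reduced c (upd p b t))).
  rewrite /expanded (big_setD1 b bN) /= updE.
  have -> : reduced b (upd p b t) = reduced b p.
    by apply: (multiaffine_reduced bN).1 => c /setD1P[cb _]; apply: updN.
  have -> // : \sum_(c in M) upd p b t c *: (sw a c * reduced c (upd p b t)) =
    \sum_(c in M) g b c *: (sw a c * reduced c (upd p b t)).
  by apply: eq_bigr => c /setD1P[cb _]; rewrite updN.
have S1 : \sum_(c in M) g b c *: (sw a c * reduced c (upd p b 1)) =
    \sum_(c in M) g b c *: (sw a c * reduced c (upd p b 0)) +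
    \sum_(c in M) g b c *: (sw a b * sw b c * D M (moving_site p) -
                            g b c *: (sw a b * D (M :\ c) (moving_site p))).
  rewrite -big_split; apply: eq_bigr => c cM /=.
  by rewrite residue_term // -scalerDr -mulrDr addrC subrK.
have S2 : sw a b * reduced b p = v *: (sw a b * D M (moving_site p)) -
    \sum_(c in M) g b c *: (sw a b * sw b c * D M (moving_site p) -
                            g b c *: (sw a b * D (M :\ c) (moving_site p))).
  rewrite /reduced mulrDr /rest_site mulrBl mulrBr -scalerAl mul1r -scalerAr -addrA.
  congr (_ + _); rewrite {1}/kz mulr_suml !mulr_sumr -!sumrN.
  rewrite (eq_bigl (mem M)); last by move=> c; rewrite !inE andbC.
  rewrite -big_split; apply: eq_bigr => c _ /=.
  by rewrite scalerBr scalerA -expr2 opprB -scalerAl -!scalerAr mulrA addrC.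
have simpl4 (x y s t : A) : v *: (x + y) - (v *: y - t + (s + t)) = v *: x - s.
  by rewrite [s + t]addrC addrA subrK opprD addrA scalerDr addrK.
by rewrite !updE' (moving_upd_in bN (subxx _)) S1 S2 scale1r scale0r add0r simpl4.
Qed.

End Residue.
End NewSite.

(** Induction on N, with z_a as variable for some a in N: there are no poles, and
    at z_a = infinity only v * D (N :\ a) remains. *)
Theorem kz_match_poly N (v : F) :
  D N (fun c => v%:A - kz z N c) = (v ^+ #|N|)%:A.
Proof.
have [m] := ubnP #|N|; elim: m N => // m IH N /ltnSE Nm.
have [->|[a aN]] := set_0Vmem N.
  by rewrite match_poly0 cards0 scale1r.
have aN' : a \notin N :\ a by rewrite !inE eqxx.
have cardN : #|N| = #|N :\ a|.+1 by rewrite (cardsD1 a) aN.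
have N'm : (#|N :\ a| < m)%N by apply: leq_trans Nm; rewrite cardN.
rewrite -{1 2}(setD1K aN) match_poly_new_site //.
have zN : {in N :\ a, forall c, z a != z c}.
  by move=> d dN; rewrite (inj_eq z_inj) eq_sym (memPn aN').
have := multiaffine_partial_fractions z_inj (multiaffine_expanded (N :\ a) a v) zN.
rewrite -[gap z a]/(pole z (z a)) => ->.
rewrite big1 ?addr0 => [|b bN]; last first.
  by rewrite expanded_residue // subrr scaler0.
rewrite /expanded big1 ?subr0 => [|c _]; last by rewrite scale0r.
rewrite (@eq_match_poly _ _ _ _ _ _ (rest_site (N :\ a) v)) => [|c _]; last first.
  by rewrite /moving_site /pencil scale0r addr0.
by rewrite IH // scalerA cardN exprS.
Qed.

End Vanishing.

(** * Antisymmetrizers and fused sites *)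

Section Antisymmetrizers.
Variables (F : fieldType) (n : nat).
Local Notation A := (galg F 'S_n).
Local Notation sw a b := (gelt F (tperm a b)).
Implicit Types (a b c : 'I_n) (N K S : {set 'I_n}).

Definition alt_sum K : A := \sum_(s : 'S_n | perm_on K s) (-1) ^+ s *: gelt F s.

Lemma alt_sum0 : alt_sum set0 = 1.
Proof.
rewrite /alt_sum (big_pred1 1%g) => [|s].
  by rewrite odd_perm1 scale1r.
by apply/idP/eqP => [/perm_on_id->//|->]; rewrite ?cards0 ?perm_on1.
Qed.

(** Every permutation of b |: K is, in a unique way, a permutation of K followed
    by the transposition of b and some k, where k = b stands for the identity. *)
Lemma alt_sumU1 K b : b \notin K ->
  alt_sum (b |: K) = alt_sum K * (1 - swap_sum F K b).
Proof.
move=> bK; pose f (p : 'S_n * 'I_n) : A :=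
  (-1) ^+ (p.1 * tperm p.2 b)%g *: gelt F (p.1 * tperm p.2 b)%g.
have -> : alt_sum K * (1 - swap_sum F K b) =
    \sum_(s | perm_on K s) \sum_(k in b |: K) f (s, k).
  rewrite mulr_suml; apply: eq_bigr => s _; rewrite big_setU1 //=.
  rewrite /f tperm1 mulg1 mulrBr mulr1 mulr_sumr -sumrN; congr (_ + _).
  apply: eq_bigr => k kK; rewrite geltM -scalerAl odd_permM odd_tperm.
  by rewrite (contraNneq _ bK) => [|<-//]; rewrite addbT signrN scaleNr.
rewrite pair_big /alt_sum (reindex_onto (fun p : 'S_n * 'I_n => p.1 * tperm p.2 b)%g
  (fun s : 'S_n => (s * tperm (s b) b, s b)%g)) /=; last first.
  by move=> s _; rewrite -mulgA tperm2 mulg1.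
apply: eq_bigl => -[s k] /=.
have onU k' : k' \in b |: K -> perm_on (b |: K) (tperm k' b).
  move=> k'K; apply: subset_trans (tperm_on _ _) _.
  by rewrite subUset !sub1set k'K setU11.
apply/andP/andP => [[on /eqP[E1 E2]]|[son kK]].
  have kE : k \in b |: K by rewrite -E2 perm_closed ?setU11.
  have sb : s b = b by move: E2; rewrite permM; case: tpermP => // ->.
  have son : perm_on (b |: K) s.
    rewrite -E1; apply: perm_onM on _; apply: onU.
    by rewrite E2.
  split=> //; apply/subsetP => i /[dup] /(subsetP son) /setU1P[->|//].
  by rewrite inE sb eqxx.
have sb : s b = b by apply: out_perm son bK.
rewrite permM sb tpermR; split.
  apply: perm_onM (onU _ kK); apply: subset_trans son (subsetUr _ _).
by rewrite -mulgA tperm2 mulg1.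
Qed.

End Antisymmetrizers.

Section FusedExpansion.
Variables (F : fieldType) (n : nat) (z : 'I_n -> F).
Hypothesis z_inj : injective z.
Local Notation A := (galg F 'S_n).
Local Notation sw a b := (gelt F (tperm a b)).
Local Notation D := (match_poly z (B := A)).
Local Notation g := (gap z).
Implicit Types (a b c : 'I_n) (N K S : {set 'I_n}).

Lemma multiaffine_monomial (V : lmodType F) N S (w : V) : S \subset N ->
  multiaffine N (fun p => (\prod_(a in S) p a) *: w).
Proof.
move=> SN; split=> [p p' pp'|b p t bN].
  by congr (_ *: _); apply: eq_bigr => a /(subsetP SN)/pp'.
have [bS|bS] := boolP (b \in S); last by rewrite !prod_upd_out // subrr scaler0 addr0.
have [l [r [E _ _]]] := prod_upd_split p bS.
by rewrite !E mulr0 mul0r scale0r add0r subr0 mulr1 scalerA -mulrA mulrCA.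
Qed.

(** Both sides are multiaffine in the poles. At infinity only S = set0 remains on
    the right and the left side is given by [kz_match_poly]. The residue at
    u = z_b is the same identity for b |: K and N :\ b. *)
Lemma fused_expansion N K (u v : F) :
    [disjoint N & K] -> {in N, forall c, u != z c} ->
  alt_sum F K *
    D N (fun c => v%:A - kz z N c - pole z u c *: (1 - swap_sum F K c)) =
  \sum_(S : {set 'I_n} | S \subset N)
    (((-1) ^+ #|S| * v ^+ (#|N| - #|S|)) * \prod_(a in S) pole z u a) *: alt_sum F (K :|: S).
Proof.
have [m] := ubnP #|N|; elim: m N K u => // m IH N K u /ltnSE Nm NK uN.
pose X := pencil (fun c => v%:A - kz z N c) (fun c => - (1 - swap_sum F K c)).
pose G p := alt_sum F K * D N (X p) - \sum_(S : {set 'I_n} | S \subset N)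
    (\prod_(a in S) p a) *: (((-1) ^+ #|S| * v ^+ (#|N| - #|S|)) *: alt_sum F (K :|: S)).
apply/eqP; rewrite -subr_eq0; apply/eqP.
transitivity (G (pole z u)).
  congr (_ * _ - _); last by apply: eq_bigr => S _; rewrite scalerA mulrC.
  by apply: eq_match_poly => c _; rewrite /X /pencil scalerN.
have mG : multiaffine N G.
  apply: multiaffineD.
    apply: (multiaffine_lin (f := *%R (alt_sum F K))) => [k x y|].
      by rewrite mulrDr scalerAr.
    exact: pencil_multiaffine.
  apply: (multiaffine_lin (f := -%R)) => [k x y|].
    by rewrite opprD scalerN.
  by apply: multiaffine_sum => S SN; apply: multiaffine_monomial.
rewrite (multiaffine_partial_fractions z_inj mG uN) [X in X + _](_ : _ = 0).
  rewrite add0r; apply: big1 => b bN; rewrite (_ : _ - _ = 0) ?scaler0 //.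
  set p := pole z (z b).
  have bK : b \notin K by rewrite (disjointFr NK).
  have bNb : b \notin N :\ b by rewrite !inE eqxx.
  have inN c : c \in N :\ b -> c \in N /\ c != b by case/setD1P.
  have XE c : c \in N :\ b -> X p c =
      v%:A - kz z (N :\ b) c - p c *: (1 - swap_sum F (b |: K) c).
    move=> /inN[cN cb]; rewrite /X /pencil (kz_setD1 z bN) // scalerN gapN.
    rewrite /swap_sum big_setU1 //= scaleNr (swC _ c b).
    have -> : 1 - (sw b c + \sum_(k in K) sw k c) = 1 - \sum_(k in K) sw k c - sw b c.
      by rewrite opprD addrA addrAC.
    set W := 1 - _; rewrite -[p c]/(g b c) [g b c *: (W - _)]scalerBr.
    by rewrite !opprD !opprK !addrA [RHS]addrAC [X in _ = X - _]addrAC.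
  have commX : {in N :\ b, forall c, GRing.comm (- (1 - swap_sum F K b)) (X p c)}.
    move=> c /[dup] cNb /inN[cN cb]; apply/commr_sym/commrN/commrB.
      exact: commr1.
    have -> : X p c = (v - p c)%:A -
        (kz z (N :\ b) c - p c *: (sw b c + swap_sum F K c)).
      rewrite XE // /swap_sum big_setU1 //= scalerBr scalerBl !opprB !addrA.
      by rewrite [LHS]addrAC [X in X + _ = _]addrAC [LHS]addrAC.
    apply: commr_sym; apply: commrB; first exact/commr_sym/comm_alg.
    apply: swap_sum_comm_fused => //.
    by rewrite -setI_eq0 setIDAC (eqP (_ : N :&: K == set0)) ?setI_eq0 // set0D.
  have zN : {in N :\ b, forall c, z b != z c}.
    by move=> c /inN[_ cb]; rewrite (inj_eq z_inj) eq_sym.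
  have NbK : [disjoint N :\ b & b |: K].
    rewrite -setI_eq0; apply/eqP/setP => i; rewrite !inE.
    have [iN|] := boolP (i \in N); rewrite ?andbF //= (disjointFr NK iN).
    by case: eqP.
  have cardN : #|N| = #|N :\ b|.+1 by rewrite (cardsD1 b) bN.
  have Nbm : (#|N :\ b| < m)%N by apply: leq_trans Nm; rewrite cardN.
  have GX t : G (upd p b t) = alt_sum F K * D N (X (upd p b t)) -
     (\sum_(S : {set 'I_n} | S \subset N :\ b)
        (\prod_(a in S) p a) *: (((-1) ^+ #|S| * v ^+ (#|N| - #|S|)) *: alt_sum F (K :|: S))
      - t *: \sum_(S : {set 'I_n} | S \subset N :\ b)
       (((-1) ^+ #|S| * v ^+ (#|N :\ b| - #|S|)) * \prod_(a in S) p a)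
         *: alt_sum F (b |: K :|: S)).
    rewrite /G (sum_subsets_setD1 _ bN) /= scaler_sumr -sumrN; congr (_ - (_ + _)).
      apply: eq_bigr => S; rewrite subsetD1 => /andP[_ bS].
      by rewrite prod_upd_out.
    apply: eq_bigr => S; rewrite subsetD1 => /andP[SN bS].
    rewrite big_setU1 //= updE prod_upd_out // cardsU1 bS cardN subSS exprS.
    by rewrite setUCA setUA -scaleNr !scalerA; congr (_ *: _); ring.
  have step : D N (X (upd p b 1)) = D N (X (upd p b 0)) +
      - (1 - swap_sum F K b) * D (N :\ b) (X p) by apply: pencil_upd_in.
  have IHb := IH (N :\ b) (b |: K) (z b) Nbm NbK zN.
  rewrite alt_sumU1 // -(eq_match_poly z XE) in IHb.
  rewrite !GX step -IHb scale1r scale0r subr0 mulrDr mulNr mulrN -mulrA.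
  apply/eqP; rewrite subr_eq0; apply/eqP.
  by rewrite opprB addrA subrK.
rewrite /G (eq_match_poly z (y := fun c => v%:A - kz z N c)); last first.
  by move=> c _; rewrite /X /pencil scale0r addr0.
rewrite kz_match_poly // (bigD1 set0) ?sub0set //= [X in _ - (_ + X)]big1 => [|S /andP[SN S0]].
  by rewrite big_set0 cards0 subn0 expr0 mul1r scale1r addr0 setU0 -scalerAr mulr1 subrr.
have/set0Pn[a aS] := S0.
by rewrite (bigD1 a) //= mul0r scale0r.
Qed.

End FusedExpansion.

(** * The polynomials Phi as sums over subsets *)

Section ExtPerm.
Variables (m n : nat) (r : 'I_m -> 'I_n).
Hypothesis r_inj : injective r.

Lemma ext_permM s t : ext_perm r (s * t)%g = (ext_perm r s * ext_perm r t)%g.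
Proof.
apply/permP => x; rewrite permM.
have [/codomP[i ->]|xr] := boolP (x \in codom r).
  by rewrite !ext_perm_in // permM.
by rewrite !ext_perm_out.
Qed.

Lemma ext_perm1 : ext_perm r 1%g = 1%g.
Proof.
apply: (mulgI (ext_perm r 1%g)).
by rewrite -ext_permM !mulg1.
Qed.

Lemma ext_perm_tperm i j : ext_perm r (tperm i j) = tperm (r i) (r j).
Proof.
apply/permP => x; have [/codomP[k ->]|xr] := boolP (x \in codom r).
  by rewrite ext_perm_in // inj_tperm.
rewrite ext_perm_out // tpermD //; by apply: contraNneq xr => <-; rewrite codom_f.
Qed.

Lemma odd_ext_perm s : ext_perm r s = s :> bool.
Proof.
case: (prod_tpermP s) => ts ->{s} _.
elim: ts => [|t ts IHts]; first by rewrite big_nil ext_perm1 !odd_perm1.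
rewrite big_cons odd_mul_tperm ext_permM odd_permM IHts ext_perm_tperm.
by rewrite odd_tperm (inj_eq r_inj).
Qed.

Lemma ext_perm_inj : injective (ext_perm r).
Proof.
move=> s t /permP st; apply/permP => i; apply: r_inj.
by rewrite -!ext_perm_in ?st.
Qed.

(** One inclusion is clear, and both sides have m! elements. *)
Lemma imset_ext_perm :
  [set ext_perm r s | s : 'S_m] = [set t | perm_on [set x in codom r] t].
Proof.
apply/eqP; rewrite eqEcard; apply/andP; split.
  apply/subsetP => _ /imsetP[s _ ->]; rewrite inE; apply/subsetP => x.
  by rewrite !inE; apply: contraR => xr; rewrite ext_perm_out.
rewrite card_imset; last exact: ext_perm_inj.
rewrite cardsE card_perm cardsE card_codom // card_ord.
by rewrite card_Sn.
Qed.

Lemma group_emb_antisymm (F : fieldType) : [pchar F] =i pred0 ->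
  m`!%:R *: group_emb r (antisymm F m) = alt_sum F [set x in codom r].
Proof.
move=> F0; have mF : m`!%:R != 0 :> F.
  by have/pcharf0P-> := F0; rewrite -lt0n fact_gt0.
transitivity (\sum_(s : 'S_m) (-1) ^+ s *: gelt F (ext_perm r s)).
  rewrite /group_emb scaler_sumr; apply: eq_bigr => s _; rewrite scalerA.
  congr (_ *: _); rewrite /antisymm !ffunE.
  rewrite [LHS](mulVKf mF) sum_ffunE (bigD1 s) //=.
  rewrite !ffunE eqxx [_ *: _]mulr1 big1 ?addr0 // => t ts.
  by rewrite !ffunE eq_sym (negPf ts) [_ *: _]mulr0.
transitivity (\sum_(t in [set ext_perm r s | s : 'S_m]) (-1) ^+ t *: gelt F t).
  rewrite big_imset /=; last by move=> s t _ _; apply: ext_perm_inj.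
  by apply: eq_bigr => s _; rewrite odd_ext_perm.
by rewrite imset_ext_perm /alt_sum; apply: eq_bigl => t; rewrite inE.
Qed.

End ExtPerm.

Section Subsets.
Variable n : nat.

Lemma sum_sorted_tuples (V : nmodType) i (f : {set 'I_n} -> V) :
  \sum_(r : i.-tuple 'I_n | sorted ltn (map val r)) f [set x in r] =
  \sum_(S : {set 'I_n} | #|S| == i) f S.
Proof.
pose h (r : i.-tuple 'I_n) := [set x in r].
transitivity (\sum_(S in
  [set h r | r in [set r : i.-tuple 'I_n | sorted ltn (map val r)]]) f S).
  rewrite big_imset /=; first by apply: eq_bigl => r; rewrite inE.
  move=> r r'; rewrite !inE => rs rs' /setP rr'; apply/val_inj/(inj_map val_inj).
  apply: (irr_sorted_eq ltn_trans ltnn) => // x.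
  by apply/mapP/mapP => -[y yr ->]; exists y => //; have := rr' y; rewrite !inE yr.
apply: eq_bigl => S; apply/imsetP/idP => [[r]|/eqP Si].
  rewrite inE => rs ->; rewrite cardsE; have := size_tuple r => {2}<-.
  apply/eqP/card_uniqP; rewrite -(map_inj_uniq val_inj).
  exact: (sorted_uniq ltn_trans ltnn).
have szS : size (enum S) == i by rewrite -cardE Si.
exists (Tuple szS); last by apply/setP => x; rewrite !inE mem_enum.
rewrite inE /= -[enum _](eq_filter (mem_enum _)).
rewrite -(eq_filter (mem_map val_inj _)) -filter_map.
by rewrite (sorted_filter ltn_trans) // unlock val_ord_enum iota_ltn_sorted.
Qed.

End Subsets.

Section PhiSets.
Variables (F : fieldType) (n : nat) (z : 'I_n -> F).
Hypothesis F0 : [pchar F] =i pred0.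
Local Notation A := (galg F 'S_n).

Lemma Phi_sets i : Phi z i = \sum_(S : {set 'I_n} | #|S| == i)
  (alt_sum F S)%:P * \prod_(b < n | b \notin S) ('X - (z b)%:A%:P).
Proof.
rewrite -sum_sorted_tuples; apply: eq_bigr => r rs; congr (_%:P * _).
  rewrite group_emb_antisymm //; last first.
    apply/tuple_uniqP; rewrite -(map_inj_uniq val_inj).
    exact: (sorted_uniq ltn_trans ltnn).
  by congr alt_sum; apply/setP => x; rewrite !inE; apply/codomP/tnthP.
by apply: eq_bigl => b; rewrite inE.
Qed.

Lemma horner_scalar_XsubC (P : pred 'I_n) (u : F) :
  (\prod_(b < n | P b) ('X - (z b)%:A%:P) : {poly A}).[u%:A] =
  (\prod_(b < n | P b) (u - z b))%:A.
Proof.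
have -> : \prod_(b < n | P b) ('X - (z b)%:A%:P) =
    map_poly (in_alg A) (\prod_(b < n | P b) ('X - (z b)%:P)).
  rewrite rmorph_prod; apply: eq_bigr => b _.
  by rewrite rmorphB /= map_polyX map_polyC.
rewrite -[u%:A]/(in_alg A u) horner_map /= horner_prod; congr (_ *: 1).
by apply: eq_bigr => b _; rewrite hornerXsubC.
Qed.

Lemma horner_Phi i (u : F) : (Phi z i).[u%:A] =
  \sum_(S : {set 'I_n} | #|S| == i)
    (\prod_(b < n | b \notin S) (u - z b)) *: alt_sum F S.
Proof.
rewrite Phi_sets horner_sum; apply: eq_bigr => S _.
by rewrite hornerCM horner_scalar_XsubC -scalerAr mulr1.
Qed.

Lemma size_Phi i : (size (Phi z i) <= (n - i).+1)%N.
Proof.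
rewrite Phi_sets; apply: (leq_trans (size_sum _ _ _)); apply/bigmax_leqP => S /eqP Si.
apply: leq_trans (size_polyMleq _ _) _; rewrite size_polyC.
rewrite -big_filter -(big_map (fun b => (z b)%:A) xpredT (fun w => 'X - w%:P)).
rewrite size_prod_XsubC size_map size_filter -sum1_count sum1_card.
have -> : #|[pred b : 'I_n | b \notin S]| = (n - i)%N.
  by rewrite -Si -[X in (X - _)%N]card_ord -(cardC (mem S)) addKn.
by case: (_ == _); rewrite /= ?add0n ?leqnSn ?addnS.
Qed.

Lemma horner_Phi_uv (u v : F) : (Phi_uv z).[v%:A%:P].[u%:A] =
  \sum_(S : {set 'I_n})
    ((-1) ^+ #|S| * v ^+ (n - #|S|) * \prod_(b < n | b \notin S) (u - z b))
      *: alt_sum F S.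
Proof.
have hM (c : {poly A}) k : (c%:P * 'X^k).[v%:A%:P].[u%:A] = v ^+ k *: c.[u%:A].
  rewrite hornerCM hornerXn; have -> : v%:A%:P ^+ k = (v ^+ k)%:A%:P :> {poly A}.
    by rewrite -polyC_exp exprZn expr1n.
  rewrite hornerM_comm ?hornerC ?mulr_algr //.
  by rewrite /comm_poly hornerC; apply: comm_alg.
have -> : Phi_uv z = \sum_(0 <= i < n.+1) ((-1) ^+ i * Phi z i)%:P * 'X^(n - i).
  rewrite big_nat_recl // subn0 expr0 mul1r; congr (_ + _).
    rewrite -commr_polyXn; congr (_%:P * _).
    rewrite Phi_sets (big_pred1 set0) => [|S]; last by rewrite cards_eq0.
    by rewrite alt_sum0 mul1r; apply: eq_bigl => b; rewrite inE.
  by rewrite big_add1; apply: eq_bigr => i _; rewrite polyCM rmorphXn rmorphN1.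
rewrite !horner_sum big_mkord.
transitivity (\sum_(i < n.+1) \sum_(S : {set 'I_n} | #|S| == i)
    ((-1) ^+ #|S| * v ^+ (n - #|S|) * \prod_(b < n | b \notin S) (u - z b))
      *: alt_sum F S).
  apply: eq_bigr => i _; rewrite hM.
  have -> : ((-1) ^+ i * Phi z i) = ((-1) ^+ i)%:A%:P * Phi z i.
    by rewrite -in_algE rmorphXn rmorphN1 polyC_exp polyCN.
  rewrite hornerCM horner_Phi mulr_algl scalerA scaler_sumr.
  by apply: eq_bigr => S /eqP->; rewrite scalerA [v ^+ _ * _]mulrC.
rewrite [RHS](partition_big (fun S : {set 'I_n} => inord #|S| : 'I_n.+1) predT) //=.
apply: eq_bigr => i _; apply: eq_bigl => S; rewrite -val_eqE /= inordK //.
by rewrite ltnS -[X in (_ <= X)%N]card_ord max_card.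
Qed.

End PhiSets.

(** * Evaluating the characteristic polynomial at KZ elements *)

Section CommutingSubstitution.
Variables (F : fieldType) (n : nat) (A : algType F) (h : 'I_n -> A).
Hypothesis h_comm : forall i j, GRing.comm (h i) (h j).
Local Notation ev := (mmap (in_alg A) h).

Lemma mmap1M m1 m2 : mmap1 h (m1 + m2)%MM = mmap1 h m1 * mmap1 h m2.
Proof.
rewrite /mmap1 -prodrM_comm => [|i j _ _]; last exact/commrX/commr_sym/commrX.
by apply: eq_bigr => i _; rewrite mnmDE exprD.
Qed.

(** Substitution of pairwise commuting elements is multiplicative, although these
    elements need not be central in A. *)
Lemma mmap_commM (p q : {mpoly F[n]}) : ev (p * q) = ev p * ev q.
Proof.
rewrite {1}(mpolyE p) {1}(mpolyE q) big_distrlr /= raddf_sum /mmap big_distrlr /=.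
apply: eq_bigr => m1 _; rewrite raddf_sum; apply: eq_bigr => m2 _ /=.
rewrite -scalerAl -scalerAr scalerA -mpolyXD mmapZ mmapX mmap1M /=.
by rewrite !mulr_algl -scalerAl -scalerAr scalerA.
Qed.

Lemma mmap_scale k (p : {mpoly F[n]}) : ev (k *: p) = k *: ev p.
Proof. by rewrite mmapZ /= mulr_algl. Qed.

Lemma mmap_match_poly (z k : 'I_n -> F) N :
  ev (match_poly z N (fun a => (k a)%:A - 'X_a)) =
  match_poly z N (fun a => (k a)%:A - h a).
Proof.
rewrite raddf_sum; apply: eq_bigr => T _ /=; rewrite mmap_scale; congr (_ *: _).
have ev1 : ev 1 = 1 by rewrite -mpolyC1 mmapC /= scale1r.
rewrite (big_morph ev mmap_commM ev1); apply: eq_bigr => a _.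
by rewrite mmapB mmap_scale ev1 mmapX mmap1U.
Qed.

End CommutingSubstitution.

Section Evaluation.

(** The hypothesis on x1, x2 replaces multiplicativity of f, since substitution
    of the h_a is not a morphism for arbitrary h. *)
Lemma horner_map_additive (B1 B2 : nzRingType) (f : {additive B1 -> B2}) x1 x2 p :
  (forall y, f (y * x1) = f y * x2) -> (map_poly f p).[x2] = f p.[x1].
Proof.
move=> fx; have fX k y : f (y * x1 ^+ k) = f y * x2 ^+ k.
  elim: k => [|k IH] in y *; first by rewrite !mulr1.
  by rewrite exprSr mulrA fx IH exprSr mulrA.
rewrite /map_poly horner_poly horner_coef raddf_sum.
by apply: eq_bigr => i _; rewrite fX.
Qed.

Lemma horner2_charpoly_entry (B : comNzRingType) (u v w q : B) (e : bool) :
  (('X%:P - w%:P%:P) * ('X *+ e - q%:P%:P) - e%:R).[v%:P].[u] =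
  (u - w) * (v *+ e - q) - e%:R.
Proof. by case: e; rewrite !hornerE. Qed.

Variables (F : fieldType) (n : nat) (z : 'I_n -> F).
Local Notation A := (galg F 'S_n).
Local Notation Ch := {mpoly F[n]}.

Lemma horner_subst_uv (h : 'I_n -> A) (p : {poly {poly Ch}}) (u v : F) :
  (subst_uv h p).[v%:A%:P].[u%:A] = mmap (in_alg A) h p.[v%:MP%:P].[u%:MP].
Proof.
have evM (k : F) (q : Ch) : mmap (in_alg A) h (q * k%:MP) =
    mmap (in_alg A) h q * k%:A.
  by rewrite mulrC mul_mpolyC mmap_scale mulr_algr.
rewrite /subst_uv (horner_map_additive (x1 := v%:MP%:P)) => [|y].
  by rewrite /= (horner_map_additive (x1 := u%:MP)) => // y; apply: evM.
by apply/polyP => i; rewrite coefMC !coef_map /= coefMC evM.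
Qed.

Lemma horner_char_uv (u v : F) : injective z -> (forall a, u != z a) ->
  (char_uv z).[v%:MP%:P].[u%:MP] =
  (\prod_a (u - z a)) *:
    match_poly z setT (fun a => (v - pole z u a)%:A - 'X_a : Ch).
Proof.
move=> z_inj uz; rewrite match_poly_det //.
have -> : (\prod_a (u - z a)) *: \det (mask [set: 'I_n]
      (cauchy_mx (fun a b => (gap z a b)%:A) (fun a => (v - pole z u a)%:A - 'X_a))) =
    \det (diag_mx (\row_a (u - z a)%:MP) *m
      ((\matrix_(a, b) (v%:MP *+ (a == b) - Qmx z a b -
                        (pole z u a)%:MP *+ (a == b))) : 'M[Ch]_n)).
  rewrite det_mulmx det_diag -mul_mpolyC rmorph_prod.
  congr (_ * _); [by apply: eq_bigr => a _; rewrite mxE|congr determinant].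
  apply/matrixP => a b; rewrite !mxE !inE /= alg_mpolyC.
  case: eqP => _; last by rewrite /gap !mulr0n sub0r subr0 alg_mpolyC.
  by rewrite !mulr1n mpolyCB addrAC.
have ZE : 'X%:P%:M - map_mx (fun c : F => c%:MP%:P%:P) (Zmx z) =
    diag_mx (\row_a ('X%:P - (z a)%:MP%:P%:P)) :> 'M[{poly {poly Ch}}]_n.
  apply/matrixP => i j; rewrite !mxE.
  by case: eqP => _; rewrite ?mulr1n ?mulr0n // !mpolyC0 subr0.
rewrite /char_uv ZE -!horner_evalE -!det_map_mx; congr determinant.
apply/matrixP => a b; rewrite 2!mxE [in LHS]mxE [LHS]/= mul_diag_mx mul_diag_mx !mxE.
rewrite !horner_evalE horner2_charpoly_entry -mpolyCB.
case: (a == b); last by rewrite !mulr0n !subr0.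
rewrite !mulr1n [RHS]mulrBr -mpolyCM /pole mulfV ?mpolyC1 //.
by rewrite subr_eq0.
Qed.

End Evaluation.

(** * The identity of polynomials and the two subalgebras *)

Section Infinite.
Variables (F : fieldType).
Hypothesis F0 : [pchar F] =i pred0.

Lemma natr_inj : injective (fun i : nat => i%:R : F).
Proof.
move=> i j /=; wlog ij : i j / (i <= j)%N.
  by move=> W ijE; have [/W->|/ltnW/W->] := leqP i j.
move/eqP; rewrite eq_sym -subr_eq0 -natrB //; have/pcharf0P-> := F0.
by rewrite subn_eq0 => ji; apply/eqP; rewrite eqn_leq ij.
Qed.

(** The scalars are central and their differences are units, so there are too
    many roots, even though the coefficients do not commute. *)
Lemma poly_eq0_scalars (A : unitAlgType F) (p : {poly A}) (bad : seq F) :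
  (forall x, x \notin bad -> p.[x%:A] = 0) -> p = 0.
Proof.
move=> p0; have [//|pN0] := eqVneq p 0.
pose pts := [seq i%:R : F | i <- iota 0 (size bad + size p)].
pose rs := [seq x <- pts | x \notin bad].
have Upts : uniq pts by rewrite map_inj_uniq ?iota_uniq //; apply: natr_inj.
have szrs : (size p <= size rs)%N.
  rewrite -(leq_add2l (size bad)) -[(_ + size p)%N](size_iota 0).
  rewrite -(size_map (fun i => i%:R : F)) -/pts size_filter.
  rewrite -(count_predC (mem bad) pts) leq_add2r -size_filter.
  apply: uniq_leq_size; first exact: filter_uniq.
  by move=> x; rewrite mem_filter => /andP[].
have := max_ring_poly_roots (rs := map (in_alg A) rs) pN0.
rewrite map_uniq_roots filter_uniq // size_map ltnNge szrs.
suff -> : all (root p) (map (in_alg A) rs) by move=> /(_ isT isT).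
apply/allP => _ /mapP[x + ->]; rewrite mem_filter => /andP[xb _].
by apply/rootP; apply: p0.
Qed.

Lemma poly2_eq0_scalars (A : unitAlgType F) (p : {poly {poly A}}) (bad : seq F) :
  (forall u v, u \notin bad -> p.[v%:A%:P].[u%:A] = 0) -> p = 0.
Proof.
move=> p0; apply/polyP => i; rewrite coef0; apply: (poly_eq0_scalars (bad := bad)) => u ub.
have -> : (p`_i).[u%:A] = (map_poly (horner_eval u%:A) p)`_i by rewrite coef_map.
rewrite [map_poly _ _](poly_eq0_scalars (bad := [::])) ?coef0 // => v _.
rewrite (horner_map_additive (x1 := v%:A%:P)) => [|y]; first exact: p0.
rewrite /= !horner_evalE hornerM_comm ?hornerC //.
by rewrite /comm_poly hornerC; apply: comm_alg.
Qed.

End Infinite.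

Section Main.
Variables (F : fieldType) (n : nat) (z : 'I_n -> F).
Hypothesis F0 : [pchar F] =i pred0.
Hypothesis z_inj : injective z.
Local Notation A := (galg F 'S_n).

Lemma KZ_kz a : KZ z a = kz z setT a.
Proof. by apply: eq_bigl => b; rewrite inE. Qed.

Lemma KZ_comm a b : GRing.comm (KZ z a) (KZ z b).
Proof.
rewrite !KZ_kz; apply: kz_comm; rewrite ?inE //.
  by move=> c _ ca; rewrite (inj_eq z_inj) eq_sym.
by move=> c _ ca; rewrite (inj_eq z_inj) eq_sym.
Qed.

Lemma prod_pole (u : F) (S : {set 'I_n}) : (forall a, u != z a) ->
  \prod_a (u - z a) * \prod_(a in S) pole z u a = \prod_(b < n | b \notin S) (u - z b).
Proof.
move=> uz; rewrite (bigID (mem S)) /= mulrAC -big_split /= big1 ?mul1r // => a _.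
by rewrite /pole mulfV // subr_eq0.
Qed.

Lemma match_poly_KZ (u v : F) : (forall a, u != z a) ->
  match_poly z setT (fun a => (v - pole z u a)%:A - KZ z a) =
  \sum_(S : {set 'I_n})
    ((-1) ^+ #|S| * v ^+ (n - #|S|) * \prod_(a in S) pole z u a) *: alt_sum F S.
Proof.
move=> uz; have := @fused_expansion _ _ z z_inj setT set0 u v.
rewrite alt_sum0 mul1r -setI_eq0 setI0 eqxx cardsT card_ord.
move=> /(_ isT (fun a _ => uz a)).
rewrite (eq_bigl predT); last by move=> S; rewrite subsetT.
under eq_bigr => S _ do rewrite set0U.
move=> <-.
apply: eq_match_poly => a _.
by rewrite KZ_kz /swap_sum big_set0 subr0 scalerBl addrAC.
Qed.

Theorem Phi_uv_char_uv : Phi_uv z = subst_uv (KZ z) (char_uv z).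
Proof.
apply/eqP; rewrite -subr_eq0; apply/eqP.
apply: (poly2_eq0_scalars F0 (bad := codom z)) => u v uz.
have {}uz a : u != z a by apply: contraNneq uz => ->; apply: codom_f.
have := horner_Phi_uv z F0 u v; move: (Phi_uv z) => P PE.
rewrite hornerD hornerN hornerD hornerN PE horner_subst_uv horner_char_uv //.
rewrite mmap_scale mmap_match_poly; last exact: KZ_comm.
rewrite match_poly_KZ // scaler_sumr -sumrB big1 // => S _.
by rewrite scalerA mulrCA prod_pole // subrr.
Qed.

Lemma agenv_sub_gens (X Y : seq A) : {subset X <= agenv <<Y>>%VS} ->
  (agenv <<X>> <= agenv <<Y>>)%VS.
Proof.
move=> XY; have XYs : (<<X>> <= agenv <<Y>>)%VS by apply/span_subvP.
apply: agenv_sub_modr; first exact: sub1_agenv.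
by rewrite -[Z in (_ <= Z)%VS]agenvM prodvSr.
Qed.

Lemma coef_Phi_bethe i k : (0 < i <= n)%N -> (Phi z i)`_k \in bethe_subalg z.
Proof.
move=> /andP[i0 iN]; have [kn|kn] := leqP k (n - i); last first.
  by rewrite nth_default ?mem0v // (leq_trans (size_Phi z F0 i)).
apply: (subvP (sub_agenv _)); apply: memv_span; apply/allpairsPdep.
exists i, (n - i - k)%N; rewrite !mem_iota i0 add1n !ltnS iN leq_subr.
by split=> //; rewrite /Phi_coef subKn.
Qed.

Lemma horner_Phi_bethe i x : (0 < i <= n)%N ->
  (Phi z i).[x%:A] \in bethe_subalg z.
Proof.
move=> iN; rewrite horner_coef; apply: memv_suml => k _.
by rewrite exprZn expr1n mulr_algr memvZ // coef_Phi_bethe.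
Qed.

Lemma alt_sum2 (a b : 'I_n) : a != b -> alt_sum F [set a; b] = 1 - gelt F (tperm a b).
Proof.
move=> ab; rewrite setUC alt_sumU1 ?inE 1?eq_sym //.
rewrite -[[set a]](setU0) alt_sumU1 ?inE // alt_sum0 /swap_sum big_set0 subr0.
by rewrite !mul1r setU0 big_set1.
Qed.

(** A subset S contributes at u = z_a only if it contains a. *)
Lemma horner_Phi2 a : (Phi z 2).[(z a)%:A] =
  (\prod_(c | c != a) (z a - z c)) *:
    ((\sum_(b | b != a) (z a - z b)^-1)%:A - KZ z a).
Proof.
rewrite horner_Phi // (bigID (fun S : {set 'I_n} => a \in S)) /=.
rewrite [X in _ + X]big1 ?addr0 => [|S /andP[_ aS]]; last first.
  by rewrite (bigD1 a) //= subrr mul0r scale0r.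
have -> : \sum_(S : {set 'I_n} | (#|S| == 2) && (a \in S))
      (\prod_(b < n | b \notin S) (z a - z b)) *: alt_sum F S =
    \sum_(b | b != a)
      (\prod_(c < n | c \notin [set a; b]) (z a - z c)) *: alt_sum F [set a; b].
  transitivity (\sum_(S in [set [set a; b] | b in [pred b | b != a]])
      (\prod_(b < n | b \notin S) (z a - z b)) *: alt_sum F S).
    apply: eq_bigl => S; apply/andP/imsetP => [[]|[b ba ->]].
      move=> /cards2P[b [c [bc ->]]]; rewrite !inE => /orP[] /eqP->.
        by exists c; rewrite // inE eq_sym.
      by exists b; rewrite // setUC.
    by rewrite inE in ba; rewrite cards2 [a == b]eq_sym ba !inE eqxx.
  rewrite big_imset //= => b c; rewrite !inE => ba ca /setP/(_ b).
  by rewrite !inE eqxx orbT (negPf ba) => /esym/eqP.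
rewrite scalerBr scalerA mulrC mulr_suml scaler_suml /KZ scaler_sumr -sumrB.
apply: eq_bigr => b ba; rewrite alt_sum2 1?eq_sym // scalerBr scalerA.
have -> // : \prod_(c < n | c \notin [set a; b]) (z a - z c) =
   (z a - z b)^-1 * \prod_(c | c != a) (z a - z c).
rewrite [in RHS](bigD1 b) //= mulKf ?subr_eq0 ?(inj_eq z_inj) 1?eq_sym //.
  by apply: eq_bigl => c; rewrite !inE negb_or.
by rewrite [_ / _]mulrC.
Qed.

Lemma KZ_bethe a : KZ z a \in bethe_subalg z.
Proof.
have [n1|n2] := leqP n 1.
  rewrite /KZ big_pred0 ?mem0v // => b; apply/negbTE; rewrite negbK; apply/eqP.
  apply/val_inj; have := leq_trans (ltn_ord a) n1; have := leq_trans (ltn_ord b) n1.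
  by rewrite !ltnS !leqn0 /= => /eqP b0 /eqP a0; rewrite b0 a0.
pose P := \prod_(c | c != a) (z a - z c).
have P0 : P != 0.
  by apply/prodf_neq0 => c ca; rewrite subr_eq0 (inj_eq z_inj) eq_sym.
have -> : KZ z a = (\sum_(b | b != a) (z a - z b)^-1)%:A -
    P^-1 *: (Phi z 2).[(z a)%:A].
  by rewrite horner_Phi2 scalerA mulVf // scale1r subKr.
apply: memvB; last by apply/memvZ/horner_Phi_bethe; rewrite n2.
by apply/memvZ/(subvP (sub1_agenv _))/memv_line.
Qed.

Lemma mmap_agenv (h : 'I_n -> A) (U : {vspace A}) (p : {mpoly F[n]}) :
  (forall a, h a \in agenv U) -> mmap (in_alg A) h p \in agenv U.
Proof.
move=> hU; have one : 1 \in agenv U by apply/(subvP (sub1_agenv _))/memv_line.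
have mul x y : x \in agenv U -> y \in agenv U -> x * y \in agenv U.
  by move=> xU yU; rewrite -agenvM memv_mul.
apply: memv_suml => m _; rewrite mulr_algl; apply: memvZ.
rewrite /mmap1; apply: (big_ind (fun x => x \in agenv U)) => // a _.
by elim: (m a) => [//|k IH]; rewrite exprS mul.
Qed.

Lemma coef_Phi_uv i : (0 < i <= n)%N ->
  (Phi_uv z)`_(n - i) = (-1) ^+ i * Phi z i.
Proof.
move=> /andP[i0 iN]; rewrite /Phi_uv; move: (Phi z) => P.
rewrite coefD coefXnM ltn_subrL i0 (leq_trans i0 iN) add0r coef_sum.
have cE j : ((-1) ^+ j * (P j)%:P * 'X^(n - j))`_(n - i) =
    if (n - i == n - j)%N then (-1) ^+ j * P j else 0.
  have -> : (-1) ^+ j * (P j)%:P = ((-1) ^+ j * P j)%:P.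
    by rewrite polyCM rmorphXn rmorphN1.
  by rewrite coefCM coefXn; case: eqP => _; rewrite ?mulr1 ?mulr0.
rewrite (bigD1_seq i) ?iota_uniq ?mem_index_iota ?i0 //= cE eqxx.
rewrite big_seq_cond big1 ?addr0 // => j.
rewrite mem_index_iota ltnS => /andP[/andP[j0 jN] ji]; rewrite cE.
by rewrite (eqn_sub2lE iN jN) eq_sym (negPf ji).
Qed.

Lemma coef_Phi_KZ i k : (0 < i <= n)%N ->
  (Phi z i)`_k \in agenv <<[seq KZ z a | a <- enum 'I_n]>>%VS.
Proof.
move=> iN; have -> : Phi z i = (-1) ^+ i * (Phi_uv z)`_(n - i).
  by rewrite coef_Phi_uv // mulrA -expr2 sqrr_sign mul1r.
rewrite Phi_uv_char_uv -signr_odd mulr_sign.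
have inKZ : (subst_uv (KZ z) (char_uv z))`_(n - i)`_k \in
    agenv <<[seq KZ z a | a <- enum 'I_n]>>%VS.
  rewrite /subst_uv coef_map /= coef_map /=; apply: mmap_agenv => a.
  apply/(subvP (sub_agenv _))/memv_span/mapP.
  by exists a; rewrite ?mem_enum.
by case: (odd i); rewrite ?coefN ?memvN.
Qed.

Theorem bethe_subalg_KZ :
  bethe_subalg z = agenv <<[seq KZ z a | a <- enum 'I_n]>>%VS.
Proof.
apply/eqP; rewrite eqEsubv; apply/andP; split; apply: agenv_sub_gens => x.
  move=> /allpairsPdep[i [j [iN jN ->]]]; apply: coef_Phi_KZ.
  by move: iN; rewrite mem_iota add1n ltnS.
by move=> /mapP[a _ ->]; apply: KZ_bethe.
Qed.

End Main.

Local Open Scope complex_scope.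

Theorem theorem4p4 (R : realType) (n : nat) (z : 'I_n -> R[i])
    (z_inj : injective z) :
  bethe_subalg z = agenv <<[seq KZ z a | a <- enum 'I_n]>>%VS /\
  Phi_uv z = subst_uv (KZ z) (char_uv z).
Proof.
have C0 : [pchar R[i]] =i pred0 by apply: Num.Theory.pchar_num.
by split; [apply: bethe_subalg_KZ | apply: Phi_uv_char_uv].
Qed.
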